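(* Let $L=L(X)$ be the free color Lie superalgebra generated by a $\Lambda$-graded set $X=\bigcup_{\lambda\in\Lambda}X_\lambda$ with $|X_\lambda|<\infty$ for all $\lambda\in\Lambda$. Then, in $\mathbb{Q}[[\Lambda]]$, $$\mathrm{ch}_\Lambda L(X)=-\sum_{n=1}^{\infty}\frac{\mu(n)}{n}\ln\bigl(1-\mathrm{ch}_\Lambda^{[n]}X\bigr),$$ where $\mathrm{ch}_\Lambda^{[n]}X=(\mathrm{ch}_\Lambda X)^{[n]}$.
   Context: $\mathbb{N}=\{1,2,\dots\}$ and $\mu$ is the Möbius function. Color Lie superalgebras: $G$ is an abelian group (written multiplicatively), $F$ a field, $\gamma:G\times G\to F^{\times}$ a bicharacter with $\gamma(g,h)\gamma(h,g)=1$; $G_+=\{g:\gamma(g,g)=1\}$ and $G_-=G\setminus G_+$ (so $\gamma(g,g)=-1$ for $g\in G_-$). A color Lie superalgebra is a $G$-graded space $L=\bigoplus_{g\in G}L_g$ with a bilinear bracket, $[L_g,L_h]\subseteq L_{gh}$, such that for $x\in L_g$, $y\in L_h$, $z\in L$: $[x,y]=-\gamma(g,h)[y,x]$ and $[x,[y,z]]=[[x,y],z]+\gamma(g,h)[y,[x,z]]$; moreover $[x,x]=0$ for $x\in L_g$, $g\in G_+$, and $[x,[x,x]]=0$ for $x\in L_g$, $g\in G_-$ (automatic unless the characteristic is 2, respectively 3). The free color Lie superalgebra $L(X)$ on a $G$-graded set $X=\bigcup_{g\in G}X_g$ is defined by the usual universal property for $G$-degree-preserving maps. Gradings: $\Lambda$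 is a countable additive abelian semigroup in which every element can be written as a sum of other elements in only finitely many ways, and $\kappa:\Lambda\to\{\pm1\}$ is a fixed homomorphism; $\Lambda_\pm=\{\lambda:\kappa(\lambda)=\pm1\}$. A $\Lambda$-graded color Lie superalgebra also has a decomposition $L=\bigoplus_{\lambda\in\Lambda}L_\lambda$ with $[L_\lambda,L_\mu]\subseteq L_{\lambda+\mu}$, and for $g\in G_\pm$ one has $L_g=\bigoplus_{\lambda\in\Lambda_\pm}(L_\lambda\cap L_g)$. The generating set $X$ is a disjoint union $X=\bigcup_\lambda X_\lambda$, its elements are also $G$-homogeneous, and an element of $X_\lambda$ has $G$-degree in $G_\pm$ according as $\lambda\in\Lambda_\pm$. $L(X)$ carries the $\Lambda$-grading in which elements of $X_\lambda$ have degree $\lambda$. Characters: $\mathbb{Q}[[\Lambda]]$ is the completion of the semigroup algebra with basis symbols $e^\lambda$ ($\lambda\in\Lambda$), $e^\lambda e^\mu=e^{\lambda+\mu}$, i.e. the algebra of all formal sums $\sum_{\lambda}f_\lambda e^\lambda$, $f_\lambda\in\mathbb{Q}$. $\mathrm{ch}_\Lambda L=\sum_\lambda(\dim L_\lambda)e^\lambda$ and $\mathrm{ch}_\Lambda X=\sum_\lambda|X_\lambda|e^\lambda$. Put $E^\lambda=\kappa(\lambda)e^\lambda$. The twisted dilation is $\bigl(\sum_\lambda f_\lambda E^\lambda\bigr)^{[m]}=\sum_\lambda f_\lambda E^{m\lambda}$ for $m\in\mathbb{N}$. $\ln$ of a series with constant term 1 is defined by the usual power series. *)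

(* Defs.v *)
From HB Require Import structures.
From mathcomp Require Import all_boot all_order all_algebra.
From mathcomp Require Import finmap all_classical.

Set Implicit Arguments.
Unset Strict Implicit.
Unset Printing Implicit Defensive.

Import GRing.Theory.
Local Open Scope classical_set_scope.
Local Open Scope ring_scope.

Section DirectSum.
Variables (F : fieldType) (V : lmodType F) (I : choiceType).

(* [c] writes [x] as a finite sum of elements of the [W i], [i] in [D]. *)
Definition decomposes (D : set I) (W : I -> set V) (x : V) (c : I -> V) : Prop :=
  [/\ finite_set [set i | c i != 0],
      forall i, D i -> W i (c i),
      forall i, ~ D i -> c i = 0
    & x = \sum_(i \in D) c i].

Definition direct_sum (U : set V) (D : set I) (W : I -> set V) : Prop :=
  (forall i, D i -> submod_closed (mem (W i)) /\ W i `<=` U) /\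
  (forall x, U x -> exists! c : I -> V, decomposes D W x c).

End DirectSum.

Definition has_dim (F : fieldType) (V : lmodType F) (W : set V) (d : nat) : Prop :=
  exists b : 'I_d -> V,
    [/\ forall j, W (b j),
        forall c : 'I_d -> F, \sum_j c j *: b j = 0 -> forall j, c j = 0
      & forall v, W v -> exists c : 'I_d -> F, v = \sum_j c j *: b j].

(* The value is meaningful only when [W] has finite dimension; it is 0 otherwise. *)
Definition dimension (F : fieldType) (V : lmodType F) (W : set V) : nat :=
  xget 0%N [set d | has_dim W d].

Section Color.
Variables (F : fieldType) (G : groupType).

Record skew_bicharacter (gamma : G -> G -> F) : Prop := SkewBicharacter {
  bichar_neq0 : forall g h, gamma g h != 0;
  bicharMl : forall g h k, gamma (g * h)%g k = gamma g k * gamma h k;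
  bicharMr : forall g h k, gamma g (h * k)%g = gamma g h * gamma g k;
  bichar_skew : forall g h, gamma g h * gamma h g = 1
}.

Variable gamma : G -> G -> F.

Definition Gplus : set G := [set g | gamma g g = 1].
Definition Gminus : set G := ~` Gplus.

Record colorLie := ColorLie {
  color_space :> lmodType F;
  br : color_space -> color_space -> color_space;
  gcomp : G -> set color_space;
  color_graded : direct_sum [set: color_space] [set: G] gcomp;
  br_linearl : forall y, linear (br^~ y);
  br_linearr : forall x, linear (br x);
  br_graded : forall g h x y,
    gcomp g x -> gcomp h y -> gcomp (g * h)%g (br x y);
  br_skew : forall g h x y,
    gcomp g x -> gcomp h y -> br x y = - (gamma g h *: br y x);
  br_jacobi : forall g h x y z, gcomp g x -> gcomp h y ->
    br x (br y z) = br (br x y) z + gamma g h *: br y (br x z);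
  br_even : forall g x, Gplus g -> gcomp g x -> br x x = 0;
  br_odd : forall g x, Gminus g -> gcomp g x -> br x (br x x) = 0
}.

Record color_hom (L H : colorLie) (f : L -> H) : Prop := ColorHom {
  color_hom_linear : linear f;
  color_hom_br : forall x y, f (br x y) = br (f x) (f y);
  color_hom_graded : forall g x, gcomp g x -> gcomp g (f x)
}.

Definition is_free_colorLie (X : Type) (degG : X -> G) (L : colorLie)
    (i : X -> L) : Prop :=
  (forall x, gcomp (degG x) (i x)) /\
  (forall (H : colorLie) (phi : X -> H),
     (forall x, gcomp (degG x) (phi x)) ->
     exists! f : L -> H, color_hom f /\ forall x, f (i x) = phi x).

End Color.

Arguments Gplus {F G} gamma.
Arguments Gminus {F G} gamma.

(* Every element is a sum of a nonempty finite sequence in only finitely many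
   ways.  (Counting ordered or unordered sums is equivalent; the condition rules
   out idempotents, in particular a neutral element.) *)
Definition finite_decompositions (Lambda : addSemigroupType) : Prop :=
  forall lambda : Lambda,
    finite_set [set s : Lambda * seq Lambda | foldr +%R s.1 s.2 = lambda].

Record sign_hom (Lambda : addSemigroupType) (kappa : Lambda -> int) : Prop := SignHom {
  sign_homP : forall lambda, kappa lambda = 1 \/ kappa lambda = -1;
  sign_homD : forall lambda mu, kappa (lambda + mu) = kappa lambda * kappa mu
}.

Section WeightGrading.
Variables (F : fieldType) (G : groupType) (gamma : G -> G -> F).
Variables (Lambda : addSemigroupType) (kappa : Lambda -> int).

Record is_weight_grading (L : colorLie gamma) (LW : Lambda -> set L) : Prop :=
  IsWeightGrading {
  weight_direct_sum : direct_sum [set: L] [set: Lambda] LW;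
  weight_br : forall lambda mu x y,
    LW lambda x -> LW mu y -> LW (lambda + mu) (br x y);
  weight_even : forall g, Gplus gamma g ->
    direct_sum (@gcomp _ _ _ L g) [set lambda | kappa lambda = 1]
      (fun lambda => LW lambda `&` @gcomp _ _ _ L g);
  weight_odd : forall g, Gminus gamma g ->
    direct_sum (@gcomp _ _ _ L g) [set lambda | kappa lambda = -1]
      (fun lambda => LW lambda `&` @gcomp _ _ _ L g)
}.

End WeightGrading.

(* The formal sum of the f_lambda e^lambda is the function lambda |-> f_lambda,
   so that Q[[Lambda]] is [Lambda -> rat] with its pointwise additive structure and
   the convolution product [smul].  The library also puts a pointwise product on
   [Lambda -> rat], which is not used here. *)
Section Series.
Variable Lambda : addSemigroupType.
Implicit Types (f g : Lambda -> rat) (u : nat -> Lambda -> rat).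

(* Sums over \N = {1, 2, ...}, computed coefficientwise.  [\sum_(_ \in _)] is 0
   when infinitely many terms are nonzero; the lemmas at the end of the file show
   that this does not occur in the sums considered here. *)
Definition ssum u : Lambda -> rat :=
  fun lambda => \sum_(n \in [set n : nat | (0 < n)%N]) u n lambda.

Definition sscale (a : rat) f : Lambda -> rat := fun lambda => a * f lambda.

Definition smul f g : Lambda -> rat := fun lambda =>
  \sum_(p \in [set p : Lambda * Lambda | p.1 + p.2 = lambda]) f p.1 * g p.2.

(* [spow f k] is f^k and [nmul k lambda] is k lambda, both for k >= 1 only:
   neither Q[[Lambda]] nor Lambda has a neutral element. *)
Definition spow f (k : nat) : Lambda -> rat := iter k.-1 (smul f) f.
Definition nmul (k : nat) (lambda : Lambda) : Lambda :=
  iter k.-1 (+%R lambda) lambda.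

(* ln (1 + f), the logarithm of the series with constant term 1 (in Q[[Lambda]]
   with a unit adjoined) whose remaining part is f. *)
Definition sln1p f : Lambda -> rat :=
  ssum (fun k => sscale ((-1) ^+ k.+1 / k%:R) (spow f k)).

Variable kappa : Lambda -> int.

(* The coefficient of E^lambda = kappa(lambda) e^lambda; recall that
   kappa(lambda)^-1 = kappa(lambda). *)
Definition Ecoef f : Lambda -> rat := fun lambda => (kappa lambda)%:~R * f lambda.

(* The sum of Ecoef f lambda E^(m lambda) over all lambda, for m >= 1. *)
Definition dilation (m : nat) f : Lambda -> rat := fun nu =>
  (kappa nu)%:~R *
    \sum_(lambda \in [set lambda | nmul m lambda = nu]) Ecoef f lambda.

End Series.

Definition mobius (n : nat) : int :=
  if all (fun p => logn p n == 1%N) (primes n) then (-1) ^+ size (primes n) else 0.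

Definition ch_set (Lambda : addSemigroupType) (X : choiceType)
    (degL : X -> Lambda) : Lambda -> rat :=
  fun lambda => (#|` fset_set [set x | degL x = lambda] |)%:R.

Definition ch_space (F : fieldType) (V : lmodType F) (Lambda : addSemigroupType)
    (W : Lambda -> set V) : Lambda -> rat :=
  fun lambda => (dimension (W lambda))%:R.

Section FiniteSupport.
Variables (Lambda : addSemigroupType) (kappa : Lambda -> int).
Hypothesis Lambda_fin : finite_decompositions Lambda.
Implicit Types (f h : Lambda -> rat) (lambda nu : Lambda).

Local Definition sum_of (n : nat) lambda : Prop :=
  exists2 s : Lambda * seq Lambda,
    foldr +%R s.1 s.2 = lambda & (size s.2).+1 = n.

Let foldr_catD (a b : Lambda) (s t : seq Lambda) :
  foldr +%R a (s ++ b :: t) = foldr +%R b s + foldr +%R a t.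
Proof. by elim: s => //= x s ->; rewrite Algebra.addrA. Qed.

Let sum_ofD m n lambda nu :
  sum_of m lambda -> sum_of n nu -> sum_of (m + n) (lambda + nu).
Proof.
move=> [[b s] /= <- <-] [[a t] /= <- <-].
by exists (a, s ++ b :: t); rewrite /= ?foldr_catD// size_cat/= addSn addnS.
Qed.

Let finite_sum_of lambda : finite_set [set n | sum_of n lambda].
Proof.
apply: sub_finite_set (finite_image (fun s => (size s.2).+1) (@Lambda_fin lambda)).
by move=> n [s sl sn]; exists s.
Qed.

Let fsum_neq0 (I : choiceType) (D : set I) (F : I -> rat) :
  \sum_(i \in D) F i != 0 -> exists2 i, D i & F i != 0.
Proof.
apply: contra_neqP => /forall2NP F0; apply: fsbig1 => i Di.
by have [//|/negP/negPn/eqP] := F0 i.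
Qed.

Let spow_sum_of m h k lambda : (0 < k)%N ->
  (forall nu, h nu != 0 -> sum_of m nu) ->
  spow h k lambda != 0 -> sum_of (m * k) lambda.
Proof.
case: k => // k _ hm; rewrite /spow/=.
elim: k lambda => [|k IH] lambda /=; first by rewrite muln1; exact: hm.
rewrite {1}/smul => /fsum_neq0[[a b] /= <-]; rewrite mulf_eq0 negb_or.
by move=> /andP[/hm ha /IH hb]; rewrite mulnS; exact: sum_ofD.
Qed.

Let dilation_sum_of m f nu : (0 < m)%N ->
  dilation kappa m f nu != 0 -> sum_of m nu.
Proof.
case: m => // m _; rewrite /dilation mulf_eq0 negb_or => /andP[_].
move=> /fsum_neq0[lambda /= <- _].
exists (lambda, nseq m lambda) => /=; last by rewrite size_nseq.
by rewrite /nmul/=; elim: m => //= m ->.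
Qed.

Lemma finite_smul lambda :
  finite_set [set p : Lambda * Lambda | p.1 + p.2 = lambda].
Proof.
apply: sub_finite_set
  (finite_image (fun s => (head s.1 s.2, s.1)) (@Lambda_fin lambda)).
by move=> [a b] /= ab; exists (b, [:: a]).
Qed.

Lemma finite_nmul m nu : (0 < m)%N ->
  finite_set [set lambda : Lambda | nmul m lambda = nu].
Proof.
case: m => // m _; apply: sub_finite_set (finite_image fst (@Lambda_fin nu)).
move=> lambda /= <-; exists (lambda, nseq m lambda) => //=.
by rewrite /nmul/=; elim: m => //= m ->.
Qed.

Lemma finite_sln1p f lambda :
  finite_set [set k | (0 < k)%N /\ spow f k lambda != 0].
Proof.
apply: sub_finite_set (finite_sum_of lambda) => k [k0 /=].
move=> /(spow_sum_of (m := 1) k0); rewrite mul1n; apply => nu _.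
by exists (nu, [::]).
Qed.

Lemma finite_sln1p_dilation f lambda :
  finite_set [set n | (0 < n)%N /\ sln1p (- dilation kappa n f) lambda != 0].
Proof.
have : finite_set (\bigcup_(N in [set n | sum_of n lambda]) `I_N.+1).
  exact: bigcup_finite.
apply: sub_finite_set => n [n0 /fsum_neq0[k /= k0]].
rewrite /sscale mulf_eq0 negb_or => /andP[_ /(spow_sum_of k0) H].
exists (n * k)%N => /=; last by rewrite ltnS leq_pmulr.
by apply: H => nu; rewrite oppr_eq0; exact: dilation_sum_of.
Qed.

End FiniteSupport.

(* Main.v *)
Require Import Defs.
From HB Require Import structures.
From mathcomp Require Import all_boot all_order all_algebra.
From mathcomp Require Import finmap all_classical zify ring.
From mathcomp Require Import monalg.

Set Implicit Arguments.
Unset Strict Implicit.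
Unset Printing Implicit Defensive.

Import Order.TTheory GRing.Theory Num.Theory.

(** Both sides are computed at a fixed weight [l]: the left one by an explicit
basis of [L], the right one by an enumeration of words.

A basis of [L].  The set [X] is countable, hence can be well ordered with the
order type of a set of natural numbers.  For a Lyndon word [w] let [b w] be the bracket
of the generators obtained by splitting [w] again and again at its smallest
proper suffix.  The elements [b w], together with the squares [br (b w) (b w)]
for the [w] of odd degree, form a basis of [L].
- They span [L].  The bracket of two of them can be rewritten as a combination
  of such elements ([hall_rewriting], the super version of the argument of
  M. Hall), so that their span is a subalgebra containing the generators, and a
  free algebra has no proper such subalgebra ([subalgebra_full]).
- They are independent.  The free associative algebra on [X] with the color
  commutator is a color Lie superalgebra ([malg_colorLie]), and [L] maps to it.
  The image of [b w] is [w] plus larger words, and that of its square is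
  [2 (w ++ w)] plus larger words ([lyndon_leads], [lyndon_sq_leads]); here [2]
  is invertible as soon as an odd degree exists.
Both statements are homogeneous, so the dimension of [LW l] is the number of
Lyndon words of weight [l] plus the number of odd Lyndon words the double of
whose weight is [l] ([weight_dim]).

The series.  The [k]-th power of the twisted dilation [ch^[n] X] enumerates the
words [w] of length [k] by [n] times their weight, with the sign
[sgnw w ^ (n + 1)] ([spow_words]).  Hence the coefficient of [l] on the right is
the sum of [mu(n) sgnw w ^ (n + 1) / (n |w|)] over the pairs [(n, w)] such that
[n] times the weight of [w] is [l] ([rhs_words]).  Every nonempty word is in
exactly one way the rotation by [r < |v|] of a power [v ^ k] of a Lyndon word
[v] ([necklace_exists], [necklace_uniq]).  Collecting the terms with the same
[v] and the same [m = n k] leaves, for each [v] and each [m] such that [m] times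
the weight of [v] is [l], the number
[sgnw v ^ m / m * \sum_(n k = m) mu(n) sgnw v ^ k], which by Moebius inversion is
[1] for [m = 1], [1] for [m = 2] and [v] odd, and [0] otherwise ([local_term]).
This is the same count. *)

(** * The lexicographic order on words *)

Section Lyndon.
Variables (d : Order.disp_t) (A : orderType d).
Notation word := (seqlexi A).
Implicit Types (u v w s t : seq A) (x y : A).

Local Notation "u <w v" := ((u : word) < (v : word))%O (at level 70).
Local Notation "u <=w v" := ((u : word) <= (v : word))%O (at level 70).

Lemma neq_nil u : (u != [::]) = (0 < size u).
Proof. by rewrite lt0n size_eq0. Qed.

Lemma prefix_split u v : prefix u v -> exists t, v = u ++ t.
Proof. by case/prefixP => t; exists t. Qed.

Lemma ltw_cat2l s u v : (s ++ u <w s ++ v) = (u <w v).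
Proof. by elim: s => //= x s IH; rewrite ltxi_cons lexx /= IH. Qed.

Lemma lew_cat u v : u <=w u ++ v.
Proof. by elim: u => [|x u IH]; rewrite ?lexi0s //= lexi_cons lexx. Qed.

(** As [v] is not longer than [u], the word [u] is not a proper prefix of [v]: the
comparison is decided by a letter, whatever follows. *)
Lemma ltw_catr u v s t : size v <= size u -> u <w v -> u ++ s <w v ++ t.
Proof.
elim: u v => [|x u IH] [|y v] //=; rewrite !ltxi_cons => vu /andP[-> /=].
by move=> /implyP h; apply/implyP => /h; exact: IH.
Qed.

Lemma ltw_catl u v s t : size u <= size v -> u != v ->
  u ++ s <w v ++ t -> u <w v.
Proof.
move=> uv nuv h; case: ltgtP (nuv) => // vu _.
by move: (lt_trans h (ltw_catr t s uv vu)); rewrite ltxx.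
Qed.

(** * Lyndon words and their standard factorization *)
Definition lyndon w :=
  (w != [::]) && all (fun k => w <w drop k w) (iota 1 (size w).-1).

Lemma lyndonP w : reflect
  (w != [::] /\ forall u v, w = u ++ v -> u != [::] -> v != [::] -> w <w v)
  (lyndon w).
Proof.
apply: (iffP andP) => -[w0 h]; split => //.
  move=> u v wuv u0 v0; move/allP: h => /(_ (size u)).
  rewrite mem_iota {3}wuv drop_size_cat //; apply.
  move: u0 v0; rewrite !neq_nil wuv size_cat; lia.
apply/allP => k; rewrite mem_iota => kw; apply: (h (take k w)).
- by rewrite cat_take_drop.
- by rewrite neq_nil size_take; case: ifP; lia.
- by rewrite neq_nil size_drop; lia.
Qed.

Lemma lyndon_neq0 w : lyndon w -> w != [::].
Proof. by case/lyndonP. Qed.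

Lemma lyndon_lt_suffix u v : lyndon (u ++ v) -> u != [::] -> v != [::] ->
  u ++ v <w v.
Proof. by case/lyndonP => _; apply. Qed.

Lemma cat_eq_cat (T : Type) (u v s t : seq T) : u ++ v = s ++ t ->
  (exists z, s = u ++ z /\ v = z ++ t) \/ (exists z, u = s ++ z /\ t = z ++ v).
Proof.
elim: u s => [|x u IH] [|y s] /=.
- by move=> ->; left; exists [::].
- by move=> ->; left; exists (y :: s).
- by move=> <-; right; exists (x :: u).
- by move=> [-> /IH[[z [-> ->]]|[z [-> ->]]]]; [left|right]; exists z.
Qed.

(** The crucial suffix is [v] itself.  If [v = u ++ t], then [v] is smaller than its
suffix [t], hence [u ++ v] is smaller than [u ++ t = v]; otherwise [u < v] is
decided by a letter. *)
Lemma lyndon_cat u v : lyndon u -> lyndon v -> u <w v -> lyndon (u ++ v).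
Proof.
move=> /[dup] lu /lyndonP[u0 hu] /[dup] lv /lyndonP[v0 hv] uv.
have uv_v : u ++ v <w v.
  have [|vu] := boolP (prefix u v).
    case/prefix_split => t vE; rewrite {2}vE ltw_cat2l; apply: (hv u) => //.
    by apply: contraTneq uv => t0; rewrite vE t0 cats0 ltxx.
  have {2}-> : v = v ++ [::] by rewrite cats0.
  have [le|/ltnW le] := leqP (size v) (size u); first exact: ltw_catr.
  rewrite -(cat_take_drop (size u) v) in uv vu *.
  set p := take _ _ in uv vu *.
  have sp : size p = size u by rewrite size_take; case: ltngtP le.
  rewrite cats0; apply: ltw_catr; rewrite ?sp //.
  apply: (@ltw_catl _ _ [::] (drop (size u) v)); rewrite ?sp ?cats0 //.
  by apply: contra vu => /eqP->; exact: prefix_prefix.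
apply/lyndonP; split; first by rewrite neq_nil size_cat; move: u0; rewrite neq_nil; lia.
move=> s t /cat_eq_cat[[z [sE vE]]|[z [uE tE]]] s0 t0.
  have [z0|z0] := eqVneq z [::]; first by rewrite [t](_ : _ = v) // vE z0.
  exact/(lt_trans uv_v)/(hv z).
have [z0|z0] := eqVneq z [::]; first by rewrite tE z0.
by rewrite tE; apply: ltw_catr; [rewrite uE size_cat; lia|exact: (hu s)].
Qed.

(** The factorization of [u ++ v] at its smallest proper suffix.  For a Lyndon word
this is the usual standard factorization, at the longest proper Lyndon suffix;
with this form it exists and is unique for all words of length at least two. *)
Definition standard u v := [/\ u != [::], v != [::] &
  forall s t, u ++ v = s ++ t -> s != [::] -> t != [::] -> v <=w t].

(** If a proper suffix [t] of [u] were smaller than [u], then either the first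
difference would make [t ++ v] smaller than [u ++ v], or [u = t ++ z], and then
[z ++ v] would be a suffix smaller than [v]. *)
Lemma standard_lyndon u v : lyndon (u ++ v) -> standard u v ->
  [/\ lyndon u, lyndon v & u <w v].
Proof.
move=> lw [u0 v0 hv]; have [_ hw] := lyndonP _ lw.
have uv_v : u ++ v <w v by exact: (hw u).
split.
- apply/lyndonP; split=> // s t uE s0 t0.
  have h : u ++ v <w t ++ v.
    apply: (hw s); rewrite ?uE ?catA //.
    by rewrite neq_nil size_cat; move: t0; rewrite neq_nil; lia.
  have st : size t < size u by rewrite uE size_cat !neq_nil in s0 *; lia.
  have [|ntu] := boolP (prefix t u).
    case/prefix_split => z uE'; move: h; rewrite uE' -catA ltw_cat2l ltNge.
    case/negP; apply: (hv t); rewrite ?uE' ?catA //.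
    by rewrite neq_nil size_cat; move: v0; rewrite neq_nil; lia.
  case: ltgtP => // [tu|ut]; last by rewrite ut ltnn in st.
  move: ntu; rewrite prefixE => ntu.
  have tu' : t <w take (size t) u.
    apply: (@ltw_catl _ _ [::] (drop (size t) u)).
    - by rewrite size_take st.
    - by rewrite eq_sym.
    - by rewrite cats0 cat_take_drop.
  move: h; rewrite -(cat_take_drop (size t) u) -catA => h.
  have := lt_trans h (ltw_catr v (drop (size t) u ++ v) _ tu').
  by rewrite size_take st leqnn => /(_ isT); rewrite ltxx.
- apply/lyndonP; split=> // s t vE s0 t0; rewrite lt_neqAle.
  apply/andP; split; last by apply: (hv (u ++ s)); rewrite -?catA ?vE // neq_nil
    size_cat; move: u0; rewrite neq_nil; lia.
  apply: contraTneq s0 => /(congr1 (fun w : seq A => size w)).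
  by rewrite vE size_cat neq_nil; lia.
- exact: le_lt_trans (lew_cat u v) uv_v.
Qed.

Lemma standard_exists w : 1 < size w -> exists u v, w = u ++ v /\ standard u v.
Proof.
move=> w1; have i0 : 0 < (size w).-1 by lia.
case: (@arg_minP _ word _ (Ordinal i0) xpredT (fun i => drop i.+1 w : word)) => //.
move=> i _ hi; exists (take i.+1 w), (drop i.+1 w); split.
  by rewrite cat_take_drop.
have lti := ltn_ord i.
split; rewrite ?neq_nil ?size_take ?size_drop; [case: ifP; lia|lia|].
move=> s t; rewrite cat_take_drop => wE s0 t0.
have ls : (size s).-1 < (size w).-1.
  by move: s0 t0; rewrite wE size_cat !neq_nil; lia.
have := hi (Ordinal ls) isT; rewrite /= prednK; last by rewrite -neq_nil.
by rewrite [X in drop (size s) X]wE drop_size_cat.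
Qed.

Lemma standard_uniq u v u' v' : standard u v -> standard u' v' ->
  u ++ v = u' ++ v' -> u = u' /\ v = v'.
Proof.
move=> [u0 v0 h] [u0' v0' h'] E.
have vv' : v = v' by apply: (@le_anti _ word); rewrite (h u') //= (h' u).
rewrite vv' in E *; have su : size u = size u'.
  by move: (congr1 size E); rewrite !size_cat => /addIn.
by split=> //; move: (congr1 (take (size u)) E); rewrite take_size_cat // su take_size_cat.
Qed.

(** This lemma and the next one cover the Lyndon words [u < v] for which the bracket
of [b u] and [b v] is [b (u ++ v)]; the others have to be rewritten. *)
Lemma standard_letter x v : lyndon v -> standard [:: x] v.
Proof.
move=> /lyndonP[v0 hv]; split=> // -[//|y s] t [_ vE] _ t0.
by have [s0|s0] := eqVneq s [::]; [rewrite vE s0|exact/ltW/(hv s)].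
Qed.

Lemma standard_cat u1 u2 v : standard u1 u2 -> lyndon v -> v <=w u2 ->
  standard (u1 ++ u2) v.
Proof.
move=> [u10 u20 hu] /lyndonP[v0 hv] vu2; split=> //.
  by rewrite neq_nil size_cat; move: u10; rewrite neq_nil; lia.
move=> s t /cat_eq_cat[[z [sE vE]]|[z [uE tE]]] s0 t0.
  by have [z0|z0] := eqVneq z [::]; [rewrite vE z0|exact/ltW/(hv z)].
have [z0|z0] := eqVneq z [::]; first by rewrite tE z0.
by rewrite tE (le_trans vu2) // (le_trans (hu s z uE s0 z0)) // lew_cat.
Qed.

(** * Powers, rotations and necklaces *)

Definition wpow k v : seq A := iter k (cat v) [::].

Lemma size_wpow k v : size (wpow k v) = k * size v.
Proof. by elim: k => //= k IH; rewrite size_cat IH mulSn. Qed.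

Lemma wpow_addn j k v : wpow (j + k) v = wpow j v ++ wpow k v.
Proof. by elim: j => //= j ->; rewrite catA. Qed.

Lemma wpow_muln j k v : wpow (j * k) v = wpow j (wpow k v).
Proof. by elim: j => //= j IH; rewrite mulSn wpow_addn IH. Qed.

Lemma wpowSr k v : wpow k.+1 v = wpow k v ++ v.
Proof. by rewrite -addn1 wpow_addn /= cats0. Qed.

Lemma wpow_rotl k u v : wpow k (u ++ v) ++ u = u ++ wpow k (v ++ u).
Proof.
elim: k => [|k IH] /=; first by rewrite cats0.
by rewrite -!catA IH. Qed.

Lemma rot_wpow r k v : r <= size v -> rot r (wpow k v) = wpow k (rot r v).
Proof.
move=> rv; case: k => [|k]; first by rewrite /= /rot.
rewrite /rot -{1 2}(cat_take_drop r v); set s := take r v; set t := drop r v.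
have rs : r = size s by rewrite size_take; case: ltngtP rv.
by rewrite rs /= -catA drop_size_cat // take_size_cat // -catA wpow_rotl catA.
Qed.

Lemma wpow_inj k u v : 0 < k -> wpow k u = wpow k v -> u = v.
Proof.
case: k => // k _ /= E; have su : size u = size v.
  by move: (congr1 size E); rewrite !size_cat !size_wpow; nia.
by move/(congr1 (take (size u))): E; rewrite take_size_cat // su take_size_cat.
Qed.

Lemma lew_wpow k u v : size u = size v -> u <=w v -> wpow k u <=w wpow k v.
Proof.
move=> suv; rewrite le_eqVlt => /orP[/eqP->//|uv].
case: k => // k /=; apply/ltW/ltw_catr => //; by rewrite suv.
Qed.

Lemma lyndon_rot v r : lyndon v -> 0 < r < size v -> v <w rot r v.
Proof.
move=> lv rv; have h : v <w drop r v.
  rewrite -{1}(cat_take_drop r v).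
  apply: lyndon_lt_suffix; rewrite ?cat_take_drop // neq_nil.
    by rewrite size_take; case: ifP; lia.
  by rewrite size_drop; lia.
exact: lt_le_trans h (lew_cat _ _).
Qed.

Lemma lyndon_rot_le v r : lyndon v -> v <=w rot r v.
Proof.
move=> lv; case: (posnP r) => [->|r0]; first by rewrite rot0.
have [|rv] := leqP (size v) r; first by move=> /rot_oversize->.
by apply/ltW/lyndon_rot => //; rewrite r0.
Qed.

(** Let [w = u ++ v].  If [v] is not a prefix of [w], the comparison of [w] with
[v ++ u] is decided inside [v].  If [w = v ++ t], then [t < u] since [w < v ++ u],
and the rotation [t ++ v] would be smaller than [w]. *)
Lemma lyndon_of_rot w : w != [::] ->
  (forall r, 0 < r < size w -> w <w rot r w) -> lyndon w.
Proof.
move=> w0 h; apply/lyndonP; split=> // u v wE u0 v0.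
have su : 0 < size u by rewrite -neq_nil.
have sv : 0 < size v by rewrite -neq_nil.
have {}h u' v' : w = u' ++ v' -> 0 < size u' -> 0 < size v' -> u' ++ v' <w v' ++ u'.
  move=> E su' sv'; rewrite -(rot_size_cat u' v') -E; apply: h.
  by rewrite E size_cat; lia.
have h1 := h _ _ wE su sv.
have [|nvw] := boolP (prefix v w); last first.
  rewrite wE in nvw *; case: (ltgtP (u ++ v : word) v) => // [vuv|/(congr1 size)]; last first.
    by rewrite size_cat; lia.
  move: nvw; rewrite prefixE => nvw.
  set p := take (size v) (u ++ v) in nvw *.
  have sp : size p = size v by rewrite size_take size_cat; case: ifP; lia.
  have vp : v <w p.
    apply: (@ltw_catl _ _ [::] (drop (size v) (u ++ v))); rewrite ?sp //.
      by rewrite eq_sym.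
    by rewrite cats0 cat_take_drop.
  move: h1; rewrite -(cat_take_drop (size v) (u ++ v)) -/p => h1.
  have := lt_trans h1 (ltw_catr u (drop (size v) (u ++ v)) _ vp).
  by rewrite sp leqnn ltxx => /(_ isT).
case/prefix_split => t wE'.
have st : size t = size u by move: (congr1 size wE'); rewrite wE !size_cat; lia.
move: h1; rewrite -wE wE' ltw_cat2l => tu.
have := h v t wE' sv; rewrite st => /(_ su) h2.
have h3 : t ++ v <w u ++ v by apply: ltw_catr; rewrite ?st.
by move: (lt_trans h2 h3); rewrite -wE wE' ltxx.
Qed.

(** Euclid's algorithm on the lengths of [u] and [v]. *)
Lemma cat_comm_wpow u v : u ++ v = v ++ u ->
  exists z i j, u = wpow i z /\ v = wpow j z.
Proof.
have [n] := ubnP (size u + size v); elim: n u v => // n IH u v ltn E.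
have [->|u0] := eqVneq u [::]; first by exists v, 0, 1; rewrite /= cats0.
have [->|v0] := eqVneq v [::]; first by exists u, 1, 0; rewrite /= cats0.
rewrite !neq_nil in u0 v0.
case: (cat_eq_cat E) => -[z [E1 E2]].
  have [||x [i [j [uE zE]]]] := IH u z; first by rewrite E1 size_cat in ltn; lia.
    by rewrite -E1 -E2.
  by exists x, i, (i + j); split=> //; rewrite E1 wpow_addn -uE -zE.
have [||x [i [j [vE zE]]]] := IH v z; first by rewrite E1 size_cat in ltn; lia.
  by rewrite -E1 -E2.
by exists x, (i + j), i; split=> //; rewrite E1 wpow_addn -vE -zE.
Qed.

Lemma rot_rot_wpow r j v k :
  exists r', rot j (wpow k (rot r v)) = rot r' (wpow k v).
Proof.
have [vr|/ltnW rv] := leqP (size v) r; first by exists j; rewrite (rot_oversize vr).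
by rewrite -rot_wpow // rot_rot_add; exists (rot_add (wpow k v) r j).
Qed.

Lemma ltn_rot_wpow r v k : 0 < size v -> exists2 r', r' < size v &
  rot r (wpow k v) = rot r' (wpow k v).
Proof.
move=> v0; elim/ltn_ind: r => r IH; have [rv|vr] := ltnP r (size v); first by exists r.
have [kr|rk] := leqP (k * size v) r.
  by exists 0 => //; rewrite rot0 rot_oversize // size_wpow.
have -> : r = (r - size v) + size v by lia.
rewrite rotD ?size_wpow; last by lia.
by rewrite rot_wpow // rot_size; apply: IH; lia.
Qed.

(** The smallest rotation [m] of [w] is a Lyndon word if it differs from all its
other rotations.  Otherwise its two parts commute, hence [m] is a power of a
shorter word, to which induction applies. *)
Lemma necklace_exists w : w != [::] -> exists v k r,
  [/\ lyndon v, 0 < k, r < size v & w = rot r (wpow k v)].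
Proof.
suff h : w != [::] -> exists v k r,
   [/\ lyndon v, 0 < k & w = rot r (wpow k v)].
  move=> /h[v [k [r [lv k0 ->]]]].
  have [|r' r'v ->] := @ltn_rot_wpow r v k; first by rewrite -neq_nil lyndon_neq0.
  by exists v, k, r'.
have [n] := ubnP (size w); elim: n w => // n IH w ltn w0.
have sw : 0 < size w by rewrite -neq_nil.
case: (@arg_minP _ word _ (Ordinal sw) xpredT (fun i => rot i w : word)) => //.
move=> i _ hi; set m := rot i w in hi.
have sm : size m = size w by rewrite size_rot.
have wm : w = rot (size w - i) m.
  by rewrite -[LHS](rotK i) /rotr size_rot.
have m0 : m != [::] by rewrite neq_nil sm; lia.
have {}hi r : m <=w rot r m.
  rewrite /m rot_rot_add.
  have : rot_add w i r < size w \/ size w <= rot_add w i r by lia.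
  case=> [l|/rot_oversize ->]; first exact: (hi (Ordinal l)).
  by have := hi (Ordinal sw) isT; rewrite /= rot0.
have [/existsP[r /andP[r0 /eqP mr]]|/existsPn hr] :=
    boolP [exists r : 'I_(size m), (0 < r) && (rot r m == m)]; last first.
  exists m, 1, (size w - i); split=> //; last by rewrite /= cats0.
  apply: lyndon_of_rot => // r /andP[r0 rm]; rewrite lt_neqAle hi andbT.
  by have := hr (Ordinal rm); rewrite r0 /= eq_sym.
rewrite /rot in mr; have := cat_take_drop r m; move: mr.
have lt := ltn_ord r.
set u := take r m; set v := drop r m => E1 E2.
have su : size u = r by rewrite size_take lt.
have sv : size v = size m - r by rewrite size_drop.
have [|z [a [b [uE vE]]]] := @cat_comm_wpow u v; first by rewrite E2 E1.
have mE : m = wpow (a + b) z by rewrite wpow_addn -uE -vE E2.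
have saz : a * size z = r by rewrite -su uE size_wpow.
have sbz : b * size z = size m - r by rewrite -sv vE size_wpow.
have z0 : z != [::] by rewrite neq_nil; case: (size z) saz; lia.
have [|//|x [k [s [lx k0 zE]]]] := IH z.
  have a0 : 0 < a by case: (a) saz; lia.
  have b0 : 0 < b by case: (b) sbz; lia.
  have sab : size m = a * size z + b * size z by lia.
  rewrite neq_nil in z0; nia.
have [r' E] := rot_rot_wpow s 0 (wpow k x) (a + b).
have [r'' ->] : exists r'', w = rot r'' (wpow (a + b) (wpow k x)).
  by rewrite wm mE zE; apply: rot_rot_wpow.
exists x, ((a + b) * k), r''; split=> //; last by rewrite wpow_muln.
by rewrite muln_gt0 k0 andbT; nia.
Qed.

Lemma wpow_lyndon_le v k r : lyndon v -> wpow k v <=w rot r (wpow k v).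
Proof.
move=> lv; have [|r' r'v ->] := @ltn_rot_wpow r v k.
  by rewrite -neq_nil lyndon_neq0.
rewrite rot_wpow; last exact: ltnW.
by apply: lew_wpow; rewrite ?size_rot //; exact: lyndon_rot_le.
Qed.

Lemma rotE_inv w w' r r' : rot r w = rot r' w' -> exists j, w = rot j w'.
Proof.
move=> /(congr1 (rotr r)); rewrite rotK => ->.
by rewrite /rotr rot_rot_add; eexists.
Qed.

(** If [v] were shorter than [v'], it would be both a prefix and a suffix of [v'],
and a Lyndon word is smaller than its proper suffixes. *)
Lemma wpow_lyndon_inj v v' k k' : lyndon v -> lyndon v' -> 0 < k -> 0 < k' ->
  wpow k v = wpow k' v' -> v = v' /\ k = k'.
Proof.
wlog le : v v' k k' / size v <= size v'.
  move=> H lv lv' k0 k0' E; have [le|/ltnW le] := leqP (size v) (size v').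
    exact: (H v v' k k').
  by have [] := H v' v k' k le lv' lv k0' k0 (esym E) => -> ->.
move=> lv lv' k0 k0' E.
have v0 := lyndon_neq0 lv; rewrite neq_nil in v0.
suff vv' : size v = size v'.
  have kk' : k = k' by move: (congr1 size E); rewrite !size_wpow vv'; nia.
  by split=> //; apply: (wpow_inj k0); rewrite E kk'.
apply/eqP; rewrite eqn_leq le leqNgt; apply/negP => lt.
case: k k0 E => // k _; case: k' k0' => // k' _ E.
have pre : prefix v v'.
  move: E => /= /(congr1 (take (size v))); rewrite take_size_cat // take_cat lt => ->.
  by rewrite prefix_take.
have suf : exists s, v' = s ++ v.
  move: E; rewrite !wpowSr => /cat_eq_cat[[z [_ vE]]|[z [_ ->]]]; last by exists z.
  by move: (congr1 size vE); rewrite size_cat; lia.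
case: suf => s v'E; case/prefix_split: (pre) => t v'E'.
have : v' <w v.
  rewrite v'E; apply: lyndon_lt_suffix; rewrite -?v'E // neq_nil //.
  by move: (congr1 size v'E); rewrite size_cat; lia.
by rewrite ltNge v'E' lew_cat.
Qed.

Lemma rot_lyndon_inj v r r' : lyndon v -> r < size v -> r' < size v ->
  rot r v = rot r' v -> r = r'.
Proof.
wlog rr' : r r' / r < r' => [H|] lv rv rv' E.
  have [lt|lt|//] := ltngtP r r'; first exact: H.
  exact/esym/H.
have r'E : r' = r + (r' - r) by lia.
move: E; rewrite {1}r'E rotD -?r'E; last exact: ltnW.
move=> /rot_inj e; have := @lyndon_rot v (r' - r) lv; rewrite -e ltxx => h.
by have /h : 0 < r' - r < size v by lia.
Qed.

Lemma necklace_uniq v v' k k' r r' : lyndon v -> lyndon v' -> 0 < k -> 0 < k' ->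
  r < size v -> r' < size v' ->
  rot r (wpow k v) = rot r' (wpow k' v') -> [/\ v = v', k = k' & r = r'].
Proof.
move=> lv lv' k0 k0' rv rv' E.
have [s Es] := rotE_inv E; have [s' Es'] := rotE_inv (esym E).
have /eqP : (wpow k v : word) == wpow k' v'.
  by rewrite eq_le {1}Es' wpow_lyndon_le //= Es wpow_lyndon_le.
move=> /wpow_lyndon_inj[]// e1 e2; rewrite -e1 -e2 in rv' E *; split=> //.
move: E; rewrite !rot_wpow; try exact: ltnW.
by move=> /(wpow_inj k0) /rot_lyndon_inj; apply.
Qed.

Lemma lyndon_sq v : lyndon (v ++ v) = false.
Proof.
apply/negP => lv; have v0 : v != [::] by case: v lv.
by have := lyndon_lt_suffix lv v0 v0; rewrite ltNge lew_cat.
Qed.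

End Lyndon.

Local Open Scope classical_set_scope.
Local Open Scope ring_scope.

(** * Linear spans *)

(** An inductive form of the linear span, so that linear maps and closure
properties are handled by induction on the combination. *)
Inductive lspan (F : fieldType) (V : lmodType F) (S : set V) : V -> Prop :=
| lspan0 : lspan S 0
| lspanZD a s v : S s -> lspan S v -> lspan S (a *: s + v).

Lemma linear_at0 (F : fieldType) (V W : lmodType F) (f : V -> W) :
  linear f -> f 0 = 0.
Proof.
move=> lf; have /eqP := lf 1 0 0.
by rewrite !scale1r addr0 -subr_eq0 opprD addNKr oppr_eq0 => /eqP.
Qed.

Section Span.
Variables (F : fieldType) (V : lmodType F).
Implicit Types (S : set V) (v : V).

Lemma lspan_mem S v : S v -> lspan S v.
Proof. by move=> Sv; rewrite -[v]scale1r -[1 *: v]addr0; apply: lspanZD => //; exact: lspan0. Qed.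

Lemma lspanD S u v : lspan S u -> lspan S v -> lspan S (u + v).
Proof. by elim=> [|a s w Ss _ IH] Sv; rewrite ?add0r // -addrA; apply: lspanZD => //; exact: IH. Qed.

Lemma lspanZ S a v : lspan S v -> lspan S (a *: v).
Proof.
by elim=> [|b s w Ss _ IH]; [rewrite scaler0; exact: lspan0|rewrite scalerDr scalerA; exact: lspanZD].
Qed.

Lemma lspanN S v : lspan S v -> lspan S (- v).
Proof. by rewrite -scaleN1r; exact: lspanZ. Qed.

End Span.

Lemma lspan_map (F : fieldType) (V V' : lmodType F) (f : V -> V') (S : set V) (T : set V') v : linear f ->
  (forall s, S s -> lspan T (f s)) -> lspan S v -> lspan T (f v).
Proof.
move=> lf Sf; have f0 : f 0 = 0.
  exact: linear_at0.
elim=> [|a s w Ss _ IH]; first by rewrite f0; exact: lspan0.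
by rewrite lf; apply: lspanD => //; apply: lspanZ; exact: Sf.
Qed.

Lemma lspan_sub (F : fieldType) (V : lmodType F) (S S' : set V) v : S `<=` lspan S' -> lspan S v -> lspan S' v.
Proof. by move=> h; apply: (@lspan_map _ _ _ idfun). Qed.

(** * Bracketings of words *)
Section WordOrder.
Variables (d : Order.disp_t) (A : orderType d).
Hypothesis wfA : well_founded (fun x y : A => (x < y)%O).

(** The lexicographic order is not well founded, as the words b, ab, aab and so on
decrease; it is so on words of bounded length. *)
Definition ltw_upto n (u v : seq A) :=
  (size u <= n)%N && ((u : seqlexi A) < v)%O.

Lemma ltw_upto_wf n : well_founded (ltw_upto n).
Proof.
suff h : forall w : seq A, (size w <= n)%N -> Acc (ltw_upto n) w.
  by move=> w; constructor => v /andP[vn _]; exact: h.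
elim: n => [|n IHn].
  case=> [_|x s]; last by rewrite ltn0.
  by constructor => v /andP[]; rewrite leqn0 size_eq0 => /eqP->; rewrite ltxx.
case=> [_|x s]; first by constructor => v /andP[_]; rewrite (ltNge (v : seqlexi A)) lexi0s.
rewrite ltnS; elim/(well_founded_induction wfA): x s => x IHx s sn.
elim: (IHn s sn) (sn) => {sn}s _ IHs sn.
constructor => -[_|y t /andP[/= tn]].
  by constructor => v /andP[_]; rewrite (ltNge (v : seqlexi A)) lexi0s.
rewrite ltxi_cons => /andP[yx /implyP h].
have [xy|xy] := leP x y; last exact: IHx.
have -> : y = x by apply: le_anti; rewrite xy yx.
by apply: IHs => //; rewrite /ltw_upto -ltnS tn h.
Qed.

End WordOrder.

Section Bracketing.
Variables (F : fieldType) (G : groupType) (gamma : G -> G -> F).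
Variables (d : Order.disp_t) (A : orderType d).

(** Equations rather than a recursive function: the image of a bracketing by a
morphism is then a bracketing for the images of the generators. *)
Definition is_bracketing (L : colorLie gamma) (gen : A -> L) (b : seq A -> L) :=
  (forall x, b [:: x] = gen x) /\
  (forall u v, standard u v -> b (u ++ v) = br (b u) (b v)).

Lemma bracketing_exists (L : colorLie gamma) (gen : A -> L) :
  exists b, is_bracketing gen b.
Proof.
pose split (w : seq A) := xget ([::], [::]) [set p | w = p.1 ++ p.2 /\ standard p.1 p.2].
(* [n] bounds the length of [w] *)
pose fix bk (n : nat) (w : seq A) {struct n} : L := if n is n'.+1 then
  if w is [:: x] then gen x else br (bk n' (split w).1) (bk n' (split w).2) else 0.
have splitE u v : standard u v -> split (u ++ v) = (u, v).
  move=> uv; rewrite /split; case: xgetP => [[u' v'] _ /= [E uv']|].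
    by have [-> ->] := standard_uniq uv' uv (esym E).
  by move=> /(_ (u, v)) [].
have bkS n w : (1 < size w)%N ->
    bk n.+1 w = br (bk n (split w).1) (bk n (split w).2).
  by case: w => [|x [|y s]].
have size_std (u v : seq A) : standard u v -> (0 < size u)%N && (0 < size v)%N.
  by case; rewrite !neq_nil => -> ->.
have bkE m n w : (0 < size w <= m)%N -> (size w <= n)%N -> bk m w = bk n w.
  elim: m n w => [|m IH] [|n] w; try lia.
  have [w1|] := ltnP 1 (size w); last by case: w => [|x [|y s]].
  have [u [v [wE /[dup] uv /size_std]]] := standard_exists w1.
  rewrite !bkS // wE splitE // size_cat /= => h1 h2 h3.
  by congr br; apply: IH; lia.
exists (fun w => bk (size w) w); split=> // u v /[dup] uv /size_std h.
have : (1 < size (u ++ v))%N by rewrite size_cat; lia.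
case E: (size (u ++ v)) => [//|n] n1; rewrite bkS ?E // splitE //=.
by rewrite size_cat in E; congr br; apply: bkE; lia.
Qed.

End Bracketing.

(** * Rewriting the brackets of basis elements *)
Section Hall.
Variables (F : fieldType) (G : groupType) (gamma : G -> G -> F).
Hypothesis gammaP : skew_bicharacter gamma.
Variable L : colorLie gamma.
Implicit Types x y z : L.

Lemma br0r x : br x 0 = 0.
Proof. exact: linear_at0 (br_linearr x). Qed.

Lemma gamma_sqr g : gamma g g = 1 \/ gamma g g = -1.
Proof.
have /eqP := bichar_skew gammaP g g.
by rewrite -expr2 sqrf_eq1 => /orP[] /eqP; [left|right].
Qed.

Lemma gamma_odd g : Gminus gamma g -> gamma g g = -1.
Proof. by case: (gamma_sqr g). Qed.

(** By the Jacobi identity, the two terms being equal because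
[gamma h h = -1]. *)
Lemma br_sq g h x y : gcomp g x -> gcomp h y -> Gminus gamma h ->
  br x (br y y) = 2 *: br (br x y) y.
Proof.
move=> xg yh oh; rewrite (br_jacobi _ xg yh) (br_skew yh (br_graded xg yh)).
rewrite bicharMr // (gamma_odd oh) mulrN1 scaleNr opprK scalerA bichar_skew //.
by rewrite scale1r scaler_nat mulr2n.
Qed.

Variables (d : Order.disp_t) (A : orderType d).
Hypothesis wfA : well_founded (fun x y : A => (x < y)%O).
Variables (degG : A -> G) (gen : A -> L).
Hypothesis gen_homog : forall a, gcomp (degG a) (gen a).
Variable b : seq A -> L.
Hypothesis bP : is_bracketing gen b.

Notation word := (seqlexi A).
Implicit Types (a c m u v w : seq A).
Local Notation "u <w v" := ((u : word) < (v : word))%O (at level 70).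
Local Notation "u <=w v" := ((u : word) <= (v : word))%O (at level 70).

Definition gdeg (w : seq A) : G := foldr (fun (e : A) g => (degG e * g)%g) 1%g w.

Lemma gdeg_cat u v : gdeg (u ++ v) = (gdeg u * gdeg v)%g.
Proof. by elim: u => [|e u IH] /=; rewrite ?mul1g // IH mulgA. Qed.

Lemma b_homog w : w != [::] -> gcomp (gdeg w) (b w).
Proof.
have [n] := ubnP (size w); elim: n w => // n IH w ltn w0.
have [w1|] := ltnP 1 (size w); last first.
  by case: (w) w0 => [|x [|y s]] //= _ _; rewrite mulg1 bP.1; exact: gen_homog.
have [u [v [wE uv]]] := standard_exists w1.
rewrite wE bP.2 // gdeg_cat; case: (uv) => u0 v0 _.
rewrite wE size_cat in ltn; rewrite !neq_nil in u0 v0.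
by apply: br_graded; apply: IH; rewrite ?neq_nil //; lia.
Qed.

Definition sq w : L := br (b w) (b w).

(** All [w] are allowed in the squares, not only the odd ones: the others contribute
the zero vector. *)
Definition basis_below (n : nat) m : set L :=
  [set x | (exists w, [/\ lyndon w, size w = n, (w <w m) & x = b w]) \/
           (exists w, [/\ lyndon w, (size w).*2 = n, (w <w m) & x = sq w])].

Lemma basis_below_mono n m m' : (m <=w m') ->
  basis_below n m `<=` basis_below n m'.
Proof.
by move=> mm' x [] [w [lw wn wm ->]]; [left|right]; exists w; split=> //;
  exact: lt_le_trans wm mm'.
Qed.

(** Two arguments up to [m], not both equal to it, only produce elements strictly
below [m]: this bound is what makes the induction work. *)
Definition rewrites_br n m := forall a c, lyndon a -> lyndon c ->
  (size a + size c)%N = n -> (a <=w m) -> (c <=w m) -> (a <w m) || (c <w m) ->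
  lspan (basis_below n m) (br (b a) (b c)).

Definition rewrites_br_sq n m := forall a w, lyndon a -> lyndon w ->
  (size a + (size w).*2)%N = n -> (a <=w m) -> (w <=w m) ->
  lspan (basis_below n m) (br (b a) (sq w)).

Lemma lyndon_homog w : lyndon w -> gcomp (gdeg w) (b w).
Proof. by move/lyndon_neq0; exact: b_homog. Qed.

Lemma lspan_skew S w w' : lyndon w -> lyndon w' ->
  lspan S (br (b w) (b w')) -> lspan S (br (b w') (b w)).
Proof.
by move=> lw lw' h; rewrite (br_skew (lyndon_homog lw') (lyndon_homog lw)); apply/lspanN/lspanZ.
Qed.

Lemma sq_even w : lyndon w -> ~ Gminus gamma (gdeg w) -> sq w = 0.
Proof. by move=> lw /contrapT h; apply: br_even h (lyndon_homog lw). Qed.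

(** Induction on the total length [n], then on the bound [m].  For Lyndon words
[a < m], either [a ++ m] is split as [(a, m)] and the bracket is [b (a ++ m)],
or [a = a' ++ a''] with [a'' < m], and the Jacobi identity for
[br (br (b a') (b a'')) (b m)] leads to the brackets of [b a'] with
[br (b a'') (b m)] and of [b a''] with [br (b a') (b m)].  The inner bracket is a
combination of elements below [m] by induction on [n], and the outer one then has
both its arguments below [m].  A bracket with a square of odd degree is twice an
iterated bracket of elements without squares. *)
Lemma hall_rewriting n m : rewrites_br n m /\ rewrites_br_sq n m.
Proof.
elim/ltn_ind: n m => n IHn m.
elim: (ltw_upto_wf wfA n m) => {}m _ IHm.
have size_pos w : lyndon w -> (0 < size w)%N by move/lyndon_neq0; rewrite neq_nil.
have below_m a c : lyndon a -> lyndon c -> (size a + size c)%N = n ->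
    (a <w m) -> (c <w m) -> lspan (basis_below n m) (br (b a) (b c)).
  move=> la lc ac am cm.
  have [eq|neq] := eqVneq a c.
    rewrite -eq; apply: lspan_mem; right; exists a; split=> //.
    by rewrite -addnn -ac -eq.
  have [lt|lt|e] := ltgtP (a : word) c; last by rewrite e eqxx in neq.
    have [|H _] := IHm c; first by rewrite /ltw_upto cm andbT -ac leq_addl.
    apply: (@lspan_sub _ _ (basis_below n c)) (H _ _ la lc _ _ _ _) => //.
    + by move=> x /(basis_below_mono (ltW cm)); exact: lspan_mem.
    + exact: ltW.
    + by rewrite lt.
  have [|H _] := IHm a; first by rewrite /ltw_upto am andbT -ac leq_addr.
  apply: (@lspan_sub _ _ (basis_below n a)) (H _ _ la lc _ _ _ _) => //.
  + by move=> x /(basis_below_mono (ltW am)); exact: lspan_mem.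
  + exact: ltW.
  + by rewrite lt orbT.
have belowB_m a w : lyndon a -> lyndon w -> (size a + (size w).*2)%N = n ->
    (a <w m) -> (w <w m) -> lspan (basis_below n m) (br (b a) (sq w)).
  move=> la lw aw am wm.
  pose m' : seq A := Order.max (a : word) w.
  have m'm : (m' <w m) by rewrite gt_max am.
  have [|_ H] := IHm m'.
    by rewrite /ltw_upto m'm andbT /m'; case: leP => _; clear -aw; lia.
  apply: (@lspan_sub _ _ (basis_below n m')) (H _ _ la lw _ _ _) => //.
  + by move=> x /(basis_below_mono (ltW m'm)); exact: lspan_mem.
  + by rewrite le_max lexx.
  + by rewrite le_max lexx orbT.
have sqE a w : lyndon a -> lyndon w -> Gminus gamma (gdeg w) ->
    br (b a) (sq w) = 2 *: br (br (b a) (b w)) (b w).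
  by move=> la lw; apply: br_sq (lyndon_homog la) (lyndon_homog lw).
(* by skew symmetry the larger word stands on the right *)
have A_m : rewrites_br n m.
  move=> a c la lc; wlog ac : a c la lc / (a <=w c).
    move=> H acn am cm acm; have [ac|/ltW ca] := leP (a : word) c; first exact: H.
    by apply: lspan_skew => //; apply: H => //; [rewrite addnC|rewrite orbC].
  move=> acn am cm acm.
  have [cm'|] := boolP (c <w m); first exact: below_m la lc acn (le_lt_trans ac cm') cm'.
  move=> ncm; have {cm acm ncm} : (c = m) /\ (a <w m).
    move: cm acm; by rewrite le_eqVlt (negPf ncm) !orbF => /eqP-> ->.
  case=> cm {}am; rewrite {}cm {c} in lc ac acn *.
  have std : standard a m -> lspan (basis_below n m) (br (b a) (b m)).
    move=> st; rewrite -bP.2 //; apply: lspan_mem; left; exists (a ++ m).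
    have lam := lyndon_cat la lc am.
    split=> //; first by rewrite size_cat.
    by apply: lyndon_lt_suffix => //; exact: lyndon_neq0.
  have [a1|] := ltnP 1 (size a); last first.
    by case: (a) la std => [|x [|y s]] //= _ std _; apply: std; exact: standard_letter.
  have [a' [a'' [aE st]]] := standard_exists a1.
  have [ma''|a''m] := leP (m : word) a''.
    by apply: std; rewrite aE; exact: standard_cat.
  have [|la' la'' lt'] := standard_lyndon _ st; first by rewrite -aE.
  have a'm := lt_trans lt' a''m.
  have iter p r : lyndon p -> lyndon r -> (size p + size r + size m)%N = n ->
      (p <w m) -> (r <w m) ->
      lspan (basis_below n m) (br (b p) (br (b r) (b m))).
    move=> lp lr prm pm rm.
    have p0 := size_pos _ lp; have r0 := size_pos _ lr.
    have [|H _] := IHn (size r + size m)%N _ m; first by clear -prm p0; lia.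
    have {H} := H r m lr lc erefl (ltW rm) (lexx _); rewrite rm => /(_ isT).
    apply: lspan_map; first exact: br_linearr.
    move=> x [] [w [lw ws wm ->]].
      by apply: below_m => //; clear -prm ws; lia.
    by apply: belowB_m => //; clear -prm ws; lia.
  rewrite aE bP.2 //.
  have J := br_jacobi (b m) (lyndon_homog la') (lyndon_homog la'').
  have -> : br (br (b a') (b a'')) (b m) =
      br (b a') (br (b a'') (b m)) - gamma (gdeg a') (gdeg a'') *: br (b a'') (br (b a') (b m)).
    by rewrite J addrK.
  rewrite aE size_cat in acn.
  by apply: lspanD; [|apply/lspanN/lspanZ]; apply: iter => //; clear -acn; lia.
split=> //.
(* the bracket with [sq m], treated last, leads to squares [sq z] with [z < m] *)
have B1 a w : lyndon a -> lyndon w -> (size a + (size w).*2)%N = n ->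
    (a <=w m) -> (w <w m) -> lspan (basis_below n m) (br (b a) (sq w)).
  move=> la lw aw am wm.
  have [am'|nam] := boolP (a <w m); first exact: belowB_m.
  have {nam}am : a = m by move: am; rewrite le_eqVlt (negPf nam) orbF => /eqP.
  rewrite {}am in la aw *.
  have [ow|/(sq_even lw) ->] := pselect (Gminus gamma (gdeg w)); last first.
    by rewrite br0r; exact: lspan0.
  rewrite sqE //; apply: lspanZ.
  have a0 := size_pos _ la; have w0 := size_pos _ lw.
  have [|H _] := IHn (size m + size w)%N _ m; first by clear -aw w0; lia.
  have {H} := H m w la lw erefl; rewrite lexx wm orbT => /(_ isT (ltW wm) isT) H.
  refine (@lspan_map F L L (fun x : L => br x (b w)) _ _ _ (br_linearl (b w)) _ H).
  move=> x [] [z [lz zs zm ->]] /=.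
    by apply: below_m => //; clear -aw zs; lia.
  rewrite /sq (br_skew (br_graded (lyndon_homog lz) (lyndon_homog lz)) (lyndon_homog lw)) -/(sq z).
  by apply/lspanN/lspanZ/belowB_m => //; clear -aw zs; lia.
move=> a w la lw aw am wm.
have [wm'|nwm] := boolP (w <w m); first exact: B1.
have {nwm}wm : w = m by move: wm; rewrite le_eqVlt (negPf nwm) orbF => /eqP.
rewrite {}wm in lw aw *.
have [ow|/(sq_even lw) ->] := pselect (Gminus gamma (gdeg m)); last first.
  by rewrite br0r; exact: lspan0.
have [e|neq] := eqVneq a m.
  by rewrite e /sq (br_odd ow (lyndon_homog lw)); exact: lspan0.
have {neq}am : (a <w m) by rewrite lt_neqAle am andbT.
rewrite sqE //; apply: lspanZ.
have a0 := size_pos _ la; have w0 := size_pos _ lw.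
have [|H _] := IHn (size a + size m)%N _ m; first by clear -aw w0; lia.
have {H} := H a m la lw erefl; rewrite lexx am => /(_ (ltW am) isT isT) H.
refine (@lspan_map F L L (fun x : L => br x (b m)) _ _ _ (br_linearl (b m)) _ H).
move=> x [] [z [lz zs zm ->]] /=.
  by apply: A_m; rewrite ?zm //; [clear -aw zs; lia|exact: ltW].
rewrite /sq (br_skew (br_graded (lyndon_homog lz) (lyndon_homog lz)) (lyndon_homog lw)) -/(sq z).
by apply/lspanN/lspanZ/B1 => //; clear -aw zs; lia.
Qed.

End Hall.

Lemma submodP (F : fieldType) (V : lmodType F) (W : set V) :
  submod_closed (mem W) -> W 0 /\ forall a u v, W u -> W v -> W (a *: u + v).
Proof.
move=> [W0 WD]; split; first exact: set_mem.
by move=> a u v Wu Wv; apply: set_mem; apply: WD; exact: mem_set.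
Qed.

(** * Projections of a direct sum *)
Section Projections.
Variables (F : fieldType) (V : lmodType F) (I : choiceType) (W : I -> set V).

Record is_projections (p : I -> V -> V) : Prop := IsProjections {
  proj_linear : forall i, linear (p i);
  proj_in : forall i x, W i (p i x);
  proj_id : forall i x, W i x -> p i x = x;
  proj_out : forall i j x, W i x -> i != j -> p j x = 0;
  proj_finite : forall x, finite_set [set i | p i x != 0];
  proj_sum : forall x, x = \sum_(i \in [set: I]) p i x
}.

Lemma fsum_lin (a : F) (f g : I -> V) :
  finite_set [set i | f i != 0] -> finite_set [set i | g i != 0] ->
  \sum_(i \in [set: I]) (a *: f i + g i) =
  a *: \sum_(i \in [set: I]) f i + \sum_(i \in [set: I]) g i.
Proof.
move=> ff fg; pose S := fset_set ([set i | f i != 0] `|` [set i | g i != 0]).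
have out i : i \notin S -> f i = 0 /\ g i = 0.
  rewrite in_fset_set ?finite_setU // => /negP; rewrite in_setE => h.
  by split; apply/eqP/negPn/negP => h'; apply: h; [left|right].
rewrite !(fsbigTE S); try by move=> i /out[e1 e2]; rewrite ?e1 ?e2 ?scaler0 ?addr0.
by rewrite big_split /= scaler_sumr.
Qed.

Lemma projections_exist : direct_sum [set: V] [set: I] W ->
  exists p, is_projections p.
Proof.
move=> [Wsub dec].
have WP i := submodP (Wsub i Logic.I).1.
have /choice [c cP] : forall x, exists c, decomposes [set: I] W x c /\
    forall c', decomposes [set: I] W x c' -> c = c'.
  by move=> x; have [c [c1 c2]] := dec x Logic.I; exists c.
have single i x : W i x -> c x = (fun j => if j == i then x else 0).
  move=> Wx; apply: (cP x).2; split=> //.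
  - apply: (sub_finite_set _ (finite_set1 i)) => j /=.
    by have [->|_] := eqVneq j i; rewrite ?eqxx.
  - by move=> j _; case: eqP => [->//|_]; exact: (WP j).1.
  - by move=> j [].
  - rewrite (fsbigTE [fset i]%fset); last by move=> j; rewrite inE => /negPf->.
    by rewrite big_seq_fset1 eqxx.
exists (fun i x => c x i); split.
- move=> i a u v; have [[fu Wu _ uE] _] := cP u; have [[fv Wv _ vE] _] := cP v.
  suff -> : c (a *: u + v) = (fun i => a *: c u i + c v i) by [].
  apply: (cP _).2; split=> //.
  + apply: (@sub_finite_set _ _ ([set i | c u i != 0] `|` [set i | c v i != 0])).
      move=> j /= h; case: (eqVneq (c u j) 0) => [e|]; last by left.
      by right; move: h; rewrite e scaler0 add0r.
    by rewrite finite_setU.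
  + by move=> j _; apply: (WP j).2; [exact: Wu|exact: Wv].
  + by move=> j [].
  + by rewrite fsum_lin // -uE -vE.
- by move=> i x; have [[_ h _ _] _] := cP x; exact: h.
- by move=> i x /single ->; rewrite eqxx.
- by move=> i j x /single -> /negPf; rewrite eq_sym => ->.
- by move=> x; have [[]] := cP x.
- by move=> x; have [[]] := cP x.
Qed.

End Projections.

(** * A free algebra is generated by its generators *)
Section Subspace.
Variables (F : fieldType) (V : lmodType F) (M : set V).
Hypothesis HM : submod_closed (mem M).

(** The proof is an argument, so that the instances on [subspace] can be found
from the type alone. *)
Definition subspace_pred (_ : submod_closed (mem M)) : V -> bool := fun x => x \in M.
Notation PM := (subspace_pred HM).

Let PM_closed : GRing.subsemimod_closed PM := GRing.submod_closed_semi HM.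

HB.instance Definition _ := GRing.isSubmodClosed.Build F V PM PM_closed.

Record subspace := Subspace { sval : V; svalP : PM sval }.

HB.instance Definition _ := [isSub for sval].
HB.instance Definition _ := [Choice of subspace by <:].
HB.instance Definition _ := [SubChoice_isSubLmodule of subspace by <:].
End Subspace.

Section Subalgebra.
Variables (F : fieldType) (G : groupType) (gamma : G -> G -> F).
Variable L : colorLie gamma.
Variables (M : set L) (HM : submod_closed (mem M)).
Hypothesis M_br : forall x y, M x -> M y -> M (br x y).
Variable p : G -> L -> L.
Hypothesis pP : is_projections (@gcomp _ _ _ L) p.
Hypothesis M_proj : forall g x, M x -> M (p g x).

Notation SM := (subspace HM).

Let valM (x : SM) : M (val x).
Proof. by apply: set_mem; exact: (valP x). Qed.

Definition mkM x (Mx : M x) : SM := Subspace (mem_set Mx : subspace_pred HM x).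

Definition sub_br (x y : SM) : SM := mkM (M_br (valM x) (valM y)).
Definition sub_gcomp g : set SM := [set x | gcomp g (val x)].

Let lval : linear (val : SM -> L).
Proof. by move=> a x y; rewrite linearP. Qed.

Let sub_graded : direct_sum [set: SM] [set: G] sub_gcomp.
Proof.
have [Lsub Ldec] := color_graded L.
have gP g := submodP (Lsub g Logic.I).1.
split.
  move=> g _; split=> //; split; first apply: mem_set.
    by rewrite /sub_gcomp /mkset raddf0; exact: (gP g).1.
  move=> a x y /set_mem gx /set_mem gy; apply: mem_set.
  by rewrite /sub_gcomp /mkset lval; exact: (gP g).2.
move=> x _.
have sum_val (c : G -> SM) : finite_set [set g | c g != 0] ->
    val (\sum_(g \in [set: G]) c g) = \sum_(g \in [set: G]) val (c g).
  move=> fc; rewrite !(fsbigTE (fset_set [set g | c g != 0])) ?raddf_sum //.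
    move=> g; rewrite in_fset_set // => /negP; rewrite in_setE => /negP/negPn/eqP ->.
    by rewrite raddf0.
  by move=> g; rewrite in_fset_set // => /negP; rewrite in_setE => /negP/negPn/eqP.
have val_neq0 (y : SM) : (val y != 0) = (y != 0).
  by rewrite -(inj_eq val_inj) raddf0.
exists (fun g => mkM (M_proj g (valM x))); split.
  have fin : finite_set [set g | mkM (M_proj g (valM x)) != 0].
    apply: (sub_finite_set _ (proj_finite pP (val x))) => g /=.
    by rewrite -val_neq0.
  split=> //.
    by move=> g _; exact: proj_in pP _ _.
    by move=> g [].
  by apply: val_inj; rewrite sum_val //= -(proj_sum pP).
move=> c [fc cg _ xE]; apply/funext => g; apply: val_inj => /=.
have [c' [_ uniq]] := Ldec (val x) Logic.I.
have e1 : c' = (fun h => p h (val x)).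
  apply: uniq; split=> //.
  - exact: proj_finite pP _.
  - by move=> h _; exact: proj_in pP _ _.
  - by move=> h [].
  - exact: proj_sum pP _.
have e2 : c' = (fun h => val (c h)).
  apply: uniq; split=> //.
  - by move=> h [].
  - by rewrite {1}xE sum_val.
by have := congr1 (fun k => k g) (etrans (esym e1) e2).
Qed.

Let val_br x y : val (sub_br x y) = br (val x) (val y).
Proof. by []. Qed.

Let valZ a (x : SM) : val (a *: x) = a *: val x.
Proof. by rewrite linearZ. Qed.

Let val0 : val (0 : SM) = 0. Proof. by rewrite raddf0. Qed.
Let valN (x : SM) : val (- x) = - val x. Proof. by rewrite raddfN. Qed.
Let valD (x y : SM) : val (x + y) = val x + val y. Proof. by rewrite raddfD. Qed.

Definition sub_colorLie : colorLie gamma.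
Proof.
apply: (@ColorLie F G gamma (subspace HM) sub_br sub_gcomp sub_graded).
- move=> y a u v; apply: val_inj; rewrite !(val_br, lval); exact: br_linearl.
- move=> y a u v; apply: val_inj; rewrite !(val_br, lval); exact: br_linearr.
- by move=> g h x y; exact: br_graded.
- move=> g h x y gx hy; apply: val_inj; rewrite valN valZ !val_br; exact: br_skew.
- move=> g h x y z gx hy; apply: val_inj.
  rewrite valD valZ !val_br; exact: br_jacobi.
- move=> g x pg gx; apply: val_inj; rewrite val0 val_br; exact: br_even pg gx.
- move=> g x pg gx; apply: val_inj; rewrite val0 !val_br; exact: br_odd pg gx.
Defined.

(** The universal property gives a morphism from [L] to the subalgebra; followed by
the inclusion it fixes the generators, hence is the identity of [L]. *)
Lemma subalgebra_full (X : Type) (degG : X -> G) (i : X -> L) :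
  is_free_colorLie degG i -> (forall x, M (i x)) -> forall x, M x.
Proof.
move=> [ig univ] Mi x.
have [f [[fhom fi] _]] := univ sub_colorLie (fun x => mkM (Mi x)) ig.
have [g [_ uniq]] := univ L i ig.
have valf : val \o f = id.
  transitivity g.
    apply/esym/uniq; split; last by move=> y; rewrite /= fi.
    split.
    - by move=> a u v; rewrite /= (color_hom_linear fhom) lval.
    - by move=> u v; rewrite /= (color_hom_br fhom).
    - by move=> h u /(color_hom_graded fhom).
  by apply: uniq; split=> //; split.
by rewrite -[x]/(id x) -valf; exact: valM.
Qed.

End Subalgebra.

(** * Weights of words *)

(** A neutral element is adjoined to [Lambda]: the empty word gets a weight, and
weights of words are sums over their letters. *)
Definition weight (Lambda : addSemigroupType) := option Lambda.

Section Weight.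
Variable Lambda : addSemigroupType.

Definition addw (a b : weight Lambda) : weight Lambda :=
  match a, b with
  | Some x, Some y => Some (x + y)
  | None, _ => b
  | _, None => a
  end.

Lemma addwA : associative addw.
Proof. by case=> [x|] [y|] [z|] //=; rewrite Algebra.addrA. Qed.
Lemma addwC : commutative addw.
Proof. by case=> [x|] [y|] //=; rewrite Algebra.addrC. Qed.
Lemma add0w : left_id None addw.
Proof. by case. Qed.

HB.instance Definition _ := Choice.on (weight Lambda).
HB.instance Definition _ := GRing.isNmodule.Build (weight Lambda) addwA addwC add0w.

Definition wt (x : Lambda) : weight Lambda := Some x.

Lemma wt_inj : injective wt.
Proof. by move=> x y []. Qed.

Lemma wtD (x y : Lambda) : wt x + wt y = wt (x + y).
Proof. by []. Qed.

Lemma wt_nmul k (x : Lambda) : (0 < k)%N -> wt x *+ k = wt (nmul k x).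
Proof.
case: k => // k _; rewrite /nmul /=; elim: k => [|k IH]; first by rewrite mulr1n.
by rewrite mulrS IH wtD.
Qed.

Variables (A : Type) (degL : A -> Lambda).

Definition wdeg (w : seq A) : weight Lambda := \sum_(x <- w) wt (degL x).

Lemma wdeg_cat u v : wdeg (u ++ v) = wdeg u + wdeg v.
Proof. exact: big_cat. Qed.

Lemma wdeg_cons x v : wdeg (x :: v) = wt (degL x) + wdeg v.
Proof. exact: big_cons. Qed.

Lemma wdeg_nil : wdeg [::] = 0.
Proof. exact: big_nil. Qed.

Lemma wdeg1 x : wdeg [:: x] = wt (degL x).
Proof. by rewrite /wdeg big_seq1. Qed.

Lemma wdeg_neq0 w : w <> [::] -> exists l, wdeg w = wt l.
Proof.
case: w => // x w _; rewrite wdeg_cons.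
by case: (wdeg w) => [l|]; [exists (degL x + l)|exists (degL x)].
Qed.

End Weight.

(** * The basis elements span *)
Section Spanning.
Variables (F : fieldType) (G : groupType) (gamma : G -> G -> F).
Hypothesis gammaP : skew_bicharacter gamma.
Variable L : colorLie gamma.
Variables (d : Order.disp_t) (A : orderType d).
Hypothesis wfA : well_founded (fun x y : A => (x < y)%O).
Variables (degG : A -> G) (gen : A -> L).
Hypothesis gen_free : is_free_colorLie degG gen.
Variable b : seq A -> L.
Hypothesis bP : is_bracketing gen b.

Notation gdeg := (gdeg degG).
Notation sq := (sq b).

Let gen_homog := gen_free.1.
Let homog_b w : lyndon w -> gcomp (gdeg w) (b w).
Proof. exact: (lyndon_homog gen_homog bP). Qed.

Let S : set L := [set x | exists w, lyndon w /\ (x = b w \/ x = sq w)].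

Let S_homog x : S x -> exists g, gcomp g x.
Proof.
move=> [w [lw [->|->]]]; first by exists (gdeg w); exact: homog_b.
by exists (gdeg w * gdeg w)%g; apply: br_graded; exact: homog_b.
Qed.

Let basis_S n m : basis_below b n m `<=` lspan S.
Proof.
move=> x [] [w [lw _ _ ->]]; apply: lspan_mem; exists w; split=> //; [by left|by right].
Qed.

Let b_span w x : lyndon w -> lspan S x -> lspan S (br (b w) x).
Proof.
move=> lw; apply: lspan_map; first exact: br_linearr.
move=> _ [v [lv [->|->]]].
  have [->|neq] := eqVneq w v; first by apply: lspan_mem; exists v; split=> //; right.
  pose m : seqlexi A := Order.max (w : seqlexi A) v.
  have [H _] := hall_rewriting gammaP wfA gen_homog bP (size w + size v) m.
  apply: lspan_sub (basis_S (m := m)) (H w v lw lv erefl _ _ _).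
  - by rewrite le_max lexx.
  - by rewrite le_max lexx orbT.
  - rewrite !lt_max !ltxx /= orbF.
    by case: ltgtP neq => // ->; rewrite eqxx.
pose m : seqlexi A := Order.max (w : seqlexi A) v.
have [_ H] := hall_rewriting gammaP wfA gen_homog bP (size w + (size v).*2) m.
apply: lspan_sub (basis_S (m := m)) (H w v lw lv erefl _ _).
- by rewrite le_max lexx.
- by rewrite le_max lexx orbT.
Qed.

Let span_br x y : lspan S x -> lspan S y -> lspan S (br x y).
Proof.
move=> Sx Sy; refine (@lspan_map F L L (fun x : L => br x y) _ _ _ (br_linearl y) _ Sx).
move=> _ [w [lw [->|->]]]; first exact: b_span.
have -> : br (sq w) y = br (b w) (br (b w) y) - gamma (gdeg w) (gdeg w) *: br (b w) (br (b w) y).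
  by rewrite {1}(br_jacobi y (homog_b lw) (homog_b lw)) addrK.
by apply: lspanD; [|apply/lspanN/lspanZ]; do 2!apply: b_span => //.
Qed.

(** The span is closed under brackets by [hall_rewriting] and under the projections
on the homogeneous components, since it is generated by homogeneous elements. *)
Lemma span_full x : lspan S x.
Proof.
have [p pP] := projections_exist (color_graded L).
have SM : GRing.submod_closed (mem (lspan S : set L)).
  split; first by apply: mem_set; exact: lspan0.
  move=> a u v /set_mem Su /set_mem Sv; apply: mem_set.
  by apply: lspanD => //; exact: lspanZ.
apply: (subalgebra_full SM span_br pP _ gen_free).
  move=> g y; apply: lspan_map; first exact: proj_linear pP g.
  move=> s Ss; have [h hs] := S_homog Ss.
  have [<-|neq] := eqVneq h g.
    by rewrite (proj_id pP hs); exact: lspan_mem.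
  by rewrite (proj_out pP hs neq); exact: lspan0.
move=> a; apply: lspan_mem; exists [:: a]; split=> //; left; exact/esym/bP.1.
Qed.

Variables (Lambda : addSemigroupType) (kappa : Lambda -> int) (degL : A -> Lambda).
Variable LW : Lambda -> set L.
Hypothesis LW_grading : is_weight_grading kappa LW.
Hypothesis LW_gen : forall x, LW (degL x) (gen x).

Notation wdeg := (wdeg degL).

Lemma b_weight w l : wdeg w = wt l -> LW l (b w).
Proof.
have [n] := ubnP (size w); elim: n w l => // n IH w l ltn.
have [w1|] := ltnP 1 (size w); last first.
  case: (w) => [|x [|y s]] //= _; first by rewrite wdeg_nil.
  by rewrite wdeg1 bP.1 => /wt_inj <-.
have [u [v [wE uv]]] := standard_exists w1.
rewrite wE bP.2 // wdeg_cat; case: (uv); rewrite !neq_nil => u0 v0 _.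
rewrite wE size_cat in ltn.
have [|lu lE] := @wdeg_neq0 _ _ degL u; first by case: (u) u0.
have [|lv lE'] := @wdeg_neq0 _ _ degL v; first by case: (v) v0.
rewrite lE lE' wtD => /wt_inj <-.
by apply: (weight_br LW_grading); apply: IH => //; lia.
Qed.

Definition weight_basis (l : Lambda) : set L :=
  [set x | (exists w, [/\ lyndon w, wdeg w = wt l & x = b w]) \/
    (exists w, [/\ lyndon w, Gminus gamma (gdeg w), wdeg w *+ 2 = wt l & x = sq w])].

Lemma weight_basis_sub l : weight_basis l `<=` LW l.
Proof.
move=> x [[w [lw wl ->]]|[w [lw ow wl ->]]]; first exact: b_weight.
have [|m mE] := @wdeg_neq0 _ _ degL w; first by move=> w0; rewrite w0 in lw.
move: wl; rewrite mE mulr2n wtD => /wt_inj <-.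
by apply: (weight_br LW_grading); exact: b_weight.
Qed.

(** Project a combination of all the basis elements to the component of weight
[l]. *)
Lemma weight_span l x : LW l x -> lspan (weight_basis l) x.
Proof.
have [p pP] := projections_exist (weight_direct_sum LW_grading).
move=> /(proj_id pP) <-.
apply: lspan_map (span_full x); first exact: proj_linear pP l.
move=> s [w [lw ws]].
have [|m mE] := @wdeg_neq0 _ _ degL w; first by move=> w0; rewrite w0 in lw.
case: ws => ->.
  have bm := b_weight mE.
  have [e|neq] := eqVneq m l; last by rewrite (proj_out pP bm neq); exact: lspan0.
  rewrite -e (proj_id pP bm); apply: lspan_mem; left; exists w; split=> //.
have [ow|/(sq_even gen_homog bP lw) ->] := pselect (Gminus gamma (gdeg w)); last first.
  by rewrite (linear_at0 (proj_linear pP l)); exact: lspan0.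
have sm : LW (m + m) (sq w) by apply: (weight_br LW_grading); exact: b_weight.
have [e|neq] := eqVneq (m + m) l; last by rewrite (proj_out pP sm neq); exact: lspan0.
rewrite -e (proj_id pP sm); apply: lspan_mem; right; exists w; split=> //.
by rewrite mE mulr2n wtD.
Qed.

End Spanning.

(** * The color commutator on a monoid algebra *)

(** The Jacobi identity of the color commutator: [x] and [y] are homogeneous of
degrees [g] and [h], [a = gamma g h], [b = gamma h g], and [zg], [zh], [zgh] are
the images of [z] by the twists of [g], [h] and [g * h]. *)
Lemma twisted_jacobi (F : fieldType) (A : lalgType F) (x y z zg zh zgh : A) (a b : F) :
  (forall c (u v : A), u * (c *: v) = c *: (u * v)) -> a * b = 1 ->
  x * (y * z - zh * y) - ((a *: y) * zg - zgh * (a *: y)) * x =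
  (x * y - a *: (y * x)) * z - zgh * (x * y - a *: (y * x)) +
  a *: (y * (x * z - zg * x) - ((b *: x) * zh - zgh * (b *: x)) * y).
Proof.
move=> scAr ab.
rewrite !mulrBr !mulrBl !scalerBr !mulrA !scAr -!scalerAl ?scalerBr ?scalerA ab ?scale1r.
rewrite !mulrA !opprB.
by rewrite [RHS](AC ((2*2)*(2*2)) (((1*8)*(3*6))*((2*5)*(4*7)))) /= !addNr !addr0.
Qed.

Section ColorCommutator.
Variables (F : fieldType) (G : groupType).
Hypothesis mulGC : forall g h : G, commute g h.
Variable gamma : G -> G -> F.
Hypothesis gammaP : skew_bicharacter gamma.
Variables (K : monomType) (degk : K -> G).
Hypothesis degkM : forall k l, degk (mmul k l) = (degk k * degk l)%g.

Notation T := {malg F[K]}.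
Implicit Types (x y z : T) (g h : G) (k l : K) (a : F).

Lemma malg_scalerAr a x y : x * (a *: y) = a *: (x * y).
Proof.
apply/malgP => k; rewrite mcoeffZ.
rewrite (@mcoeffMlw _ _ _ _ _ (a *: y) _ (fsubset_refl _) (msuppZ_le a y)) mcoeffMl mulr_sumr.
apply: eq_bigr => u _; rewrite mulr_sumr; apply: eq_bigr => v _.
by rewrite mcoeffZ mulrnAr mulrCA.
Qed.

(** The automorphism that multiplies the component of degree [h] by [gamma g h];
[x * y - twist g y * x] is the color commutator when [x] has degree [g]. *)
Definition twist g y : T := [malg k in msupp y => gamma g (degk k) * y@_k].

Lemma mcoeff_twist g y k : (twist g y)@_k = gamma g (degk k) * y@_k.
Proof.
rewrite mcoeffE; case: ifPn => // ky.
by rewrite mcoeff_outdom // mulr0.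
Qed.

Lemma msupp_twist g y : (msupp (twist g y) `<=` msupp y)%fset.
Proof.
apply/fsubsetP => k; rewrite -!mcoeff_neq0 mcoeff_twist mulf_eq0 negb_or.
by case/andP.
Qed.

Lemma twist_linear g : linear (twist g).
Proof.
move=> a x y; apply/malgP => k.
by rewrite mcoeffD mcoeffZ !mcoeff_twist mcoeffD mcoeffZ; ring.
Qed.

Lemma twistM g x y : twist g (x * y) = twist g x * twist g y.
Proof.
apply/malgP => k.
rewrite mcoeff_twist (mcoeffMlw _ (msupp_twist g x) (msupp_twist g y)) mcoeffMl mulr_sumr.
apply: eq_bigr => u _; rewrite mulr_sumr; apply: eq_bigr => v _.
rewrite !mcoeff_twist; case: eqP => [<-|_]; last by rewrite !mulr0n mulr0.
by rewrite degkM bicharMr // !mulr1n; ring.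
Qed.

Lemma twist_comp g h y : twist g (twist h y) = twist (g * h)%g y.
Proof. by apply/malgP => k; rewrite !mcoeff_twist bicharMl // mulrA. Qed.

Definition homog g : set T := [set x | forall k, x@_k != 0 -> degk k = g].

Lemma twist_homog g h y : homog h y -> twist g y = gamma g h *: y.
Proof.
move=> hy; apply/malgP => k; rewrite mcoeff_twist mcoeffZ.
have [->|/hy ->//] := eqVneq y@_k 0; by rewrite !mulr0.
Qed.

Lemma homogM g h x y : homog g x -> homog h y -> homog (g * h)%g (x * y).
Proof.
move=> gx hy k; rewrite mcoeff_neq0 => /msuppM_le[u [v [ux vy ->]]].
by rewrite degkM gx ?hy ?mcoeff_neq0.
Qed.

Lemma homog_lin g a x y : homog g x -> homog g y -> homog g (a *: x + y).
Proof.
move=> gx gy k; rewrite mcoeffD mcoeffZ.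
by have [->|/gx//] := eqVneq x@_k 0; rewrite mulr0 add0r => /gy.
Qed.

(** The extension of [twist g y * x] to a bilinear map, for [x] not homogeneous. *)
Definition opp_mul x y : T := \sum_(u <- msupp x) twist (degk u) y * << x@_u *g u >>.

Lemma opp_mulEw (D : {fset K}) x y : (msupp x `<=` D)%fset ->
  opp_mul x y = \sum_(u <- D) twist (degk u) y * << x@_u *g u >>.
Proof.
move=> xD; apply: big_fset_incl => // k _ /mcoeff_outdom ->.
by rewrite monalgU0 mulr0.
Qed.

Lemma opp_mul_homog g x y : homog g x -> opp_mul x y = twist g y * x.
Proof.
move=> gx; rewrite [in RHS](monalgE x) mulr_sumr /opp_mul big_seq [RHS]big_seq.
by apply: eq_bigr => u; rewrite -mcoeff_neq0 => /gx ->.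
Qed.

Definition comm x y : T := x * y - opp_mul x y.

Lemma commE g x y : homog g x -> comm x y = x * y - twist g y * x.
Proof. by move=> gx; rewrite /comm (opp_mul_homog _ gx). Qed.

Lemma comm_homog g h x y : homog g x -> homog h y ->
  comm x y = x * y - gamma g h *: (y * x).
Proof. by move=> gx hy; rewrite /comm (opp_mul_homog _ gx) (twist_homog _ hy) scalerAl. Qed.

Lemma comm_linearl y : linear (comm^~ y).
Proof.
move=> a u v; rewrite /comm.
have uD : (msupp u `<=` msupp u `|` msupp v)%fset by exact: fsubsetUl.
have vD : (msupp v `<=` msupp u `|` msupp v)%fset by exact: fsubsetUr.
have uvD : (msupp (a *: u + v) `<=` msupp u `|` msupp v)%fset.
  apply: fsubset_trans (msuppD_le _ _) _; apply: fsetSU; exact: msuppZ_le.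
rewrite (opp_mulEw _ uD) (opp_mulEw _ vD) (opp_mulEw _ uvD).
have -> : \sum_(w <- (msupp u `|` msupp v)%fset) twist (degk w) y * << (a *: u + v)@_w *g w >> =
  a *: \sum_(w <- (msupp u `|` msupp v)%fset) twist (degk w) y * << u@_w *g w >> +
  \sum_(w <- (msupp u `|` msupp v)%fset) twist (degk w) y * << v@_w *g w >>.
  rewrite scaler_sumr -big_split /=; apply: eq_bigr => w _.
  rewrite mcoeffD mcoeffZ monalgUD mulrDr; congr (_ + _).
  rewrite -malg_scalerAr; congr (_ * _); apply/malgP => k.
  by rewrite mcoeffZ !mcoeffU mulrnAr.
by rewrite mulrDl -scalerAl scalerBr opprD addrACA.
Qed.

Lemma comm_linearr x : linear (comm x).
Proof.
move=> a u v; rewrite /comm /opp_mul mulrDr malg_scalerAr.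
have -> : \sum_(w <- msupp x) twist (degk w) (a *: u + v) * << x@_w *g w >> =
  a *: \sum_(w <- msupp x) twist (degk w) u * << x@_w *g w >> +
  \sum_(w <- msupp x) twist (degk w) v * << x@_w *g w >>.
  rewrite scaler_sumr -big_split /=; apply: eq_bigr => w _.
  by rewrite twist_linear mulrDl -scalerAl.
by rewrite scalerBr opprD addrACA.
Qed.

Lemma comm_graded g h x y : homog g x -> homog h y -> homog (g * h)%g (comm x y).
Proof.
move=> gx hy; rewrite (comm_homog gx hy) addrC -scaleNr; apply: homog_lin.
  by rewrite mulGC; exact: homogM.
exact: homogM.
Qed.

Lemma comm_skew g h x y : homog g x -> homog h y -> comm x y = - (gamma g h *: comm y x).
Proof.
move=> gx hy; rewrite (comm_homog gx hy) (comm_homog hy gx) scalerBr scalerA.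
by rewrite bichar_skew // scale1r opprB.
Qed.

Lemma comm_jacobi g h x y z : homog g x -> homog h y ->
  comm x (comm y z) = comm (comm x y) z + gamma g h *: comm y (comm x z).
Proof.
move=> gx hy; rewrite (commE z (comm_graded gx hy)) (comm_homog gx hy).
rewrite !(commE _ gx) !(commE _ hy).
have tB g0 u v : twist g0 (u - v) = twist g0 u - twist g0 v.
  by rewrite addrC -scaleN1r twist_linear scaleN1r addrC.
rewrite !tB !twistM !twist_comp (twist_homog _ gx) (twist_homog _ hy).
rewrite -(mulGC g h); apply: twisted_jacobi; last exact: bichar_skew.
exact: malg_scalerAr.
Qed.

Lemma comm_even g x : Gplus gamma g -> homog g x -> comm x x = 0.
Proof. by move=> pg gx; rewrite (comm_homog gx gx) [gamma g g]pg scale1r subrr. Qed.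

Lemma comm_odd g x : Gminus gamma g -> homog g x -> comm x (comm x x) = 0.
Proof.
move=> pg gx; rewrite (comm_homog gx (comm_graded gx gx)) (comm_homog gx gx).
have g1 := gamma_odd gammaP pg.
by rewrite bicharMr // g1 mulrNN mulr1 scale1r scaleN1r opprK mulrDr mulrDl mulrA subrr.
Qed.

Lemma mcoeff_fsum (f : G -> T) k : finite_set [set g | f g != 0] ->
  (forall g, homog g (f g)) -> (\sum_(g \in [set: G]) f g)@_k = (f (degk k))@_k.
Proof.
move=> ff hf; rewrite (fsbigTE (degk k |` fset_set [set g | f g != 0])%fset); last first.
  move=> g; rewrite !inE negb_or in_fset_set // => /andP[_ /negP].
  by rewrite in_setE => /negP/negPn/eqP.
rewrite raddf_sum /= (big_fsetD1 (degk k)) /=; last by rewrite !inE eqxx.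
rewrite big1_fset ?addr0 // => g; rewrite !inE => /andP[gk _] _.
by apply/eqP; apply: contraNT gk => /hf ->.
Qed.

Lemma homog_direct : direct_sum [set: T] [set: G] homog.
Proof.
split.
  move=> g _; split=> //; split.
    by apply: mem_set => k; rewrite mcoeff0 eqxx.
  by move=> a x y /set_mem gx /set_mem gy; apply: mem_set; exact: homog_lin.
move=> x _; pose part g : T := [malg k in msupp x => if degk k == g then x@_k else 0].
have partE g k : (part g)@_k = if degk k == g then x@_k else 0.
  by rewrite mcoeffE; case: ifPn => // kx; rewrite mcoeff_outdom ?if_same.
have hp g : homog g (part g).
  by move=> k; rewrite partE; have [//|_] := eqVneq (degk k) g; rewrite eqxx.
have fp : finite_set [set g | part g != 0].
  apply: (sub_finite_set _ (finite_image degk (finite_fset (msupp x)))) => g /= pg.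
  have [k ] : exists k, (part g)@_k != 0.
    apply: contrapT => /forallNP h; case/eqP: pg; apply/malgP => k; rewrite mcoeff0.
    by apply/eqP/negPn/negP; exact: h.
  rewrite partE; have [<- kx|_] := eqVneq (degk k) g; last by rewrite eqxx.
  by exists k; rewrite //= -mcoeff_neq0.
exists part; split.
  split=> // [i []//|].
  by apply/malgP => k; rewrite mcoeff_fsum // partE eqxx.
move=> c [fc hc _ xE]; apply/funext => g; apply/malgP => k.
have {}hc h : homog h (c h) by exact: hc.
rewrite partE; case: eqP => [<-|ne]; first by rewrite {1}xE mcoeff_fsum.
by apply/esym/eqP; apply: contra_notT ne => /hc.
Qed.

Definition malg_colorLie : colorLie gamma :=
  ColorLie homog_direct comm_linearl comm_linearr comm_graded comm_skew
    comm_jacobi comm_even comm_odd.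

End ColorCommutator.

(** * Leading words *)
Section Leading.
Variables (F : fieldType) (G : groupType).
Hypothesis mulGC : forall g h : G, commute g h.
Variable gamma : G -> G -> F.
Hypothesis gammaP : skew_bicharacter gamma.
Variables (d : Order.disp_t) (A : orderType d) (degG : A -> G).

Notation K := {fmonom A}.
Definition fgdeg (k : K) : G := gdeg degG k.

Lemma fgdegM (k l : K) : fgdeg (mmul k l) = (fgdeg k * fgdeg l)%g.
Proof. by rewrite /fgdeg fmM gdeg_cat. Qed.

Definition tensor_colorLie := malg_colorLie mulGC gammaP fgdegM.
Notation T := tensor_colorLie.

Definition letter (a : A) : T := << FMonom [:: a] >> : {malg F[K]}.

Lemma letter_homog a : gcomp (degG a) (letter a).
Proof.
move=> k; rewrite mcoeffU1; case: (FMonom _ =P k) => [<- _|]; last by rewrite eqxx.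
by rewrite /fgdeg /= mulg1.
Qed.

Definition coef (x : T) (w : seq A) : F := mcoeff (FMonom w) (x : {malg F[K]}).

Notation word := (seqlexi A).
Implicit Types (u v w s t : seq A).
Local Notation "u <w v" := ((u : word) < (v : word))%O (at level 70).
Local Notation "u <=w v" := ((u : word) <= (v : word))%O (at level 70).

(** The length is part of the condition: without it the smallest word of a product
need not be the product of the smallest words. *)
Definition leads (c : F) w (x : T) := coef x w = c /\
  forall u, coef x u != 0 -> size u = size w /\ (w <=w u).

Lemma lew_cat2 u v u' v' : size u = size u' -> u <=w u' -> v <=w v' ->
  u ++ v <=w u' ++ v'.
Proof.
move=> su; rewrite le_eqVlt => /orP[/eqP <-|lt _].
  by rewrite !le_eqVlt => /orP[/eqP->|lt]; rewrite ?eqxx // ltw_cat2l lt orbT.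
by apply/ltW/ltw_catr => //; rewrite su.
Qed.

Lemma leads_mul c c' w w' (x y : {malg F[K]}) :
  leads c w x -> leads c' w' y -> leads (c * c') (w ++ w') (x * y).
Proof.
move=> [xw xs] [yw ys]; split.
  have h1 := fsubsetUr [fset FMonom w]%fset (msupp x).
  have h2 := fsubsetUr [fset FMonom w']%fset (msupp y).
  rewrite /coef (mcoeffMlw _ h1 h2).
  rewrite (big_fsetD1 (FMonom w)) /=; last by rewrite !inE eqxx.
  rewrite (big_fsetD1 (FMonom w')) /=; last by rewrite !inE eqxx.
  rewrite [mmul _ _]fmmulE eqxx mulr1n -/(coef x w) -/(coef y w') xw yw.
  rewrite !big1_fset ?addr0 //.
    move=> [k]; rewrite !inE => /andP[kw]; rewrite (negPf kw) /= => kx _.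
    rewrite big1_fset // => -[l] _ _; rewrite [mmul _ _]fmmulE.
    rewrite -mcoeff_neq0 in kx; have [sk _] := xs _ kx.
    case: eqP => // -[/(congr1 (take (size w)))].
    by rewrite -{1}sk !take_size_cat // => e; rewrite e eqxx in kw.
  move=> [k]; rewrite !inE => /andP[kw] _ _; rewrite [mmul _ _]fmmulE.
  case: eqP => // -[/eqP]; rewrite eqseq_cat // eqxx /= => /eqP e.
  by rewrite e eqxx in kw.
move=> u; rewrite /coef mcoeff_neq0 => /msuppM_le[[u1] [[u2] [h1 h2]]].
rewrite [mmul _ _]fmmulE => -[->].
rewrite -!mcoeff_neq0 in h1 h2.
have [s1 l1] := xs _ h1; have [s2 l2] := ys _ h2.
by rewrite !size_cat s1 s2; split=> //; apply: lew_cat2.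
Qed.

Lemma leads_larger c c' w w' a (x y : T) : leads c w x -> leads c' w' y ->
  size w = size w' -> w <w w' -> leads c w (x - a *: y).
Proof.
move=> [xw xs] [yw ys] sw ww'; split.
  rewrite /coef mcoeffB mcoeffZ -/(coef x w) -/(coef y w) xw.
  have [->|/ys[_]] := eqVneq (coef y w) 0; first by rewrite mulr0 subr0.
  by rewrite leNgt ww'.
move=> u; rewrite /coef mcoeffB mcoeffZ -/(coef x u) -/(coef y u).
have [->|/xs[su wu] _] := eqVneq (coef x u) 0; last by [].
have [->|/ys[su wu] _] := eqVneq (coef y u) 0; first by rewrite mulr0 subr0 eqxx.
by split; [rewrite su|exact/ltW/(lt_le_trans ww')].
Qed.

Variable b : seq A -> T.
Hypothesis bP : is_bracketing letter b.

(** With [w = u ++ v], the leading words of the two products in the commutator are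
[u ++ v] and [v ++ u], and the first one is smaller since [w < v]. *)
Lemma lyndon_leads w : lyndon w -> leads 1 w (b w).
Proof.
have [n] := ubnP (size w); elim: n w => // n IH w ltn lw.
have [w1|] := ltnP 1 (size w); last first.
  case: (w) (lyndon_neq0 lw) => [|x [|y s]] // _ _.
  rewrite bP.1 /letter; split; first by rewrite /coef mcoeffU1 eqxx.
  move=> u; rewrite /coef mcoeffU1; case: (_ =P FMonom u) => [[<-] //|].
  by rewrite eqxx.
have [u [v [wE uv]]] := standard_exists w1; rewrite wE in lw ltn *.
have [lu lv _] := standard_lyndon lw uv.
have [u0 v0] := (lyndon_neq0 lu, lyndon_neq0 lv).
have Iu : leads 1 u (b u).
  by apply: IH => //; move: ltn; rewrite size_cat; rewrite neq_nil in v0; lia.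
have Iv : leads 1 v (b v).
  by apply: IH => //; move: ltn; rewrite size_cat; rewrite neq_nil in u0; lia.
rewrite bP.2 //.
have -> : br (b u) (b v) = comm gamma fgdeg (b u) (b v) by [].
have hu := lyndon_homog letter_homog bP lu; have hv := lyndon_homog letter_homog bP lv.
rewrite (comm_homog gamma hu hv).
apply: (@leads_larger 1 1 _ (v ++ u)).
- by have := leads_mul Iu Iv; rewrite mulr1.
- by have := leads_mul Iv Iu; rewrite mulr1.
- by rewrite !size_cat addnC.
- exact: lt_le_trans (lyndon_lt_suffix lw u0 v0) (lew_cat _ _).
Qed.

Lemma two_neq0 g : Gminus gamma g -> (2 : F) != 0.
Proof.
move=> og; apply/eqP => h; apply: og; rewrite /Gplus /mkset.
have [//|->] := gamma_sqr gammaP g.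
by apply/eqP; rewrite -subr_eq0 -opprD oppr_eq0 -(natrD _ 1 1) h.
Qed.

Lemma lyndon_sq_leads w : lyndon w -> Gminus gamma (gdeg degG w) ->
  leads 2 (w ++ w) (sq b w).
Proof.
move=> lw ow; have hw := lyndon_homog letter_homog bP lw.
have -> : sq b w = comm gamma fgdeg (b w) (b w) by [].
rewrite (comm_homog gamma hw hw) (gamma_odd gammaP ow) scaleN1r opprK.
have [h1 h2] := leads_mul (lyndon_leads lw) (lyndon_leads lw).
split=> [|u]; rewrite /coef mcoeffD.
  by rewrite [X in X + X]h1 mulr1 -(natrD _ 1 1).
move=> h; apply: h2; apply: contraNneq h => h.
by rewrite [X in X + X]h addr0.
Qed.

End Leading.

(** * Dimensions *)

(** The matrix of one basis in terms of the other has independent rows. *)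
Lemma has_dim_le (F : fieldType) (V : lmodType F) (W : set V) m n :
  has_dim W m -> has_dim W n -> (m <= n)%N.
Proof.
move=> [b [bW bfree _]] [c [_ _ cgen]].
have /choice [M Mb] : forall j, exists a : 'I_n -> F, b j = \sum_k a k *: c k.
  by move=> j; apply: cgen.
pose B : 'M[F]_(m, n) := \matrix_(j, k) M j k.
suff : row_free B by rewrite -row_leq_rank => /leq_trans; apply; exact: rank_leq_col.
rewrite -kermx_eq0; apply/eqP/row_matrixP => i; rewrite row0.
have /sub_kermxP kB : (row i (kermx B) <= kermx B)%MS by exact: row_sub.
set u := row i _ in kB *; apply/rowP => j; rewrite [RHS]mxE.
apply: (bfree (fun j => u 0 j)).
under eq_bigr do rewrite Mb scaler_sumr.
rewrite exchange_big /= big1 // => k _.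
under eq_bigr do rewrite scalerA.
rewrite -scaler_suml; move/rowP/(_ k): kB; rewrite mxE [RHS]mxE => e.
by rewrite [X in X *: _](_ : _ = 0) ?scale0r // -[RHS]e; apply: eq_bigr => l _; rewrite [B _ _]mxE.
Qed.

Lemma dimension_eq (F : fieldType) (V : lmodType F) (W : set V) n :
  has_dim W n -> dimension W = n.
Proof.
move=> Wn; rewrite /dimension; case: xgetP => [m _ Wm|/(_ n) //].
by apply/eqP; rewrite eqn_leq !(@has_dim_le _ _ W).
Qed.

Section Independence.
Variables (F : fieldType) (G : groupType).
Hypothesis mulGC : forall g h : G, commute g h.
Variable gamma : G -> G -> F.
Hypothesis gammaP : skew_bicharacter gamma.
Variables (d : Order.disp_t) (A : orderType d) (degG : A -> G).
Notation T := (tensor_colorLie mulGC gammaP degG).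
Notation tcoef := (@coef _ _ mulGC _ gammaP _ _ degG).
Notation tleads := (@leads _ _ mulGC _ gammaP _ _ degG).

(** In a vanishing combination, look at the coefficient of the smallest leading word
that occurs: a single element contributes to it. *)
Lemma leads_free n (w : 'I_n -> seq A) (x : 'I_n -> T) (l : 'I_n -> F) :
  injective w -> (forall j, l j != 0) -> (forall j, tleads (l j) (w j) (x j)) ->
  forall c : 'I_n -> F, \sum_j c j *: x j = 0 -> forall j, c j = 0.
Proof.
move=> winj l0 lx c c0 j; apply/eqP/negPn/negP => cj.
case: (@arg_minP _ (seqlexi A) _ j (fun i => c i != 0) w cj) => i ci imin.
have : tcoef (\sum_j c j *: x j) (w i) = 0.
  by rewrite c0 /coef mcoeff0.
rewrite /coef raddf_sum /= (bigD1 i) //= big1.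
  rewrite addr0 mcoeffZ => /eqP; rewrite mulf_eq0 (negPf ci) /=.
  by have [+ _] := lx i; rewrite /coef => ->; rewrite (negPf (l0 i)).
move=> k ki; rewrite mcoeffZ; have [->|ck] := eqVneq (c k) 0; first by rewrite mul0r.
have [e|ne] := eqVneq (tcoef (x k) (w i)) 0; first by rewrite -/(tcoef _ _) e mulr0.
have [_ /(_ _ ne)[_ ki']] := lx k.
case/eqP: ki; apply: winj; apply: (@le_anti _ (seqlexi A)); rewrite ki' /=.
exact: imin.
Qed.

Hypothesis wfA : well_founded (fun x y : A => (x < y)%O).
Variables (L : colorLie gamma) (gen : A -> L).
Hypothesis gen_free : is_free_colorLie degG gen.
Variables (Lambda : addSemigroupType) (kappa : Lambda -> int) (degL : A -> Lambda).
Variable LW : Lambda -> set L.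
Hypothesis LW_grading : is_weight_grading kappa LW.
Hypothesis LW_gen : forall x, LW (degL x) (gen x).

Definition lyndon_of (l : Lambda) : set (seq A) :=
  [set w | lyndon w /\ wdeg degL w = wt l].
Definition lyndon_half (l : Lambda) : set (seq A) :=
  [set w | [/\ lyndon w, Gminus gamma (gdeg degG w) & wdeg degL w *+ 2 = wt l]].

(** The basis is indexed by the leading words: [w] for [b w], and [w ++ w], which is
not a Lyndon word, for the square. *)
Lemma weight_dim l : finite_set (lyndon_of l) -> finite_set (lyndon_half l) ->
  has_dim (LW l) (#|` fset_set (lyndon_of l)| + #|` fset_set (lyndon_half l)|).
Proof.
set D1 := lyndon_of l; set D2 := lyndon_half l => f1 f2.
have [b bP] := bracketing_exists gen.
have [f [[fhom fgen] _]] := gen_free.2 T _ (@letter_homog _ _ mulGC _ gammaP _ _ degG).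
have fbP : is_bracketing (@letter _ _ mulGC _ gammaP _ _ degG) (f \o b).
  split=> [x|u v uv]; first by rewrite /= bP.1 fgen.
  by rewrite /= bP.2 // (color_hom_br fhom).
pose s1 : seq (seq A) := fset_set D1; pose s2 : seq (seq A) := fset_set D2.
have s1P w : reflect (D1 w) (w \in s1).
  by rewrite /s1 in_fset_set //; apply: (iffP idP); rewrite in_setE.
have s2P w : reflect (D2 w) (w \in s2).
  by rewrite /s2 in_fset_set //; apply: (iffP idP); rewrite in_setE.
pose s := s1 ++ [seq w ++ w | w <- s2].
have us : uniq s.
  rewrite cat_uniq fset_uniq /=; apply/andP; split.
    apply/hasPn => _ /mapP[w /s2P [lw _ _] ->]; apply/negP => /s1P[].
    by rewrite lyndon_sq.
  rewrite map_inj_uniq ?fset_uniq // => u v E.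
  have su : size u = size v by move: (congr1 size E); rewrite !size_cat; lia.
  by move/(congr1 (take (size u))): E; rewrite take_size_cat // su take_size_cat.
pose vec (u : seq A) : L := if lyndon u then b u else sq b (take (size u)./2 u).
have vec1 w : lyndon w -> vec w = b w by rewrite /vec => ->.
have vec2 w : vec (w ++ w) = sq b w.
  by rewrite /vec lyndon_sq size_cat addnn doubleK take_size_cat.
have -> : (#|` fset_set D1| + #|` fset_set D2|)%N = size s.
  by rewrite size_cat size_map.
exists (fun j : 'I_(size s) => vec (nth [::] s j)); split.
- move=> j; apply: (weight_basis_sub bP LW_grading LW_gen (degG := degG)).
  have := mem_nth [::] (ltn_ord j); rewrite mem_cat => /orP[/s1P[lw wl]|].
    by left; exists (nth [::] s j); rewrite vec1.
  by move=> /mapP[w /s2P [lw ow wl] ->]; right; exists w; rewrite vec2.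
- move=> c c0.
  (* the leading coefficients in the free associative algebra *)
  pose lc (j : 'I_(size s)) : F := if lyndon (nth [::] s j) then 1 else 2.
  apply: (@leads_free _ (fun j => nth [::] s j) (fun j => f (vec (nth [::] s j))) lc).
  + by move=> i j /eqP; rewrite nth_uniq // => /eqP/val_inj.
  + move=> j; rewrite /lc; case: ifPn => [_|nl]; first exact: oner_neq0.
    have := mem_nth [::] (ltn_ord j); rewrite mem_cat => /orP[/s1P[lw]|].
      by rewrite lw in nl.
    by move=> /mapP[w /s2P [lw ow wl] _]; apply: two_neq0 ow.
  + move=> j; rewrite /lc.
    have := mem_nth [::] (ltn_ord j); rewrite mem_cat => /orP[/s1P[lw wl]|].
      by rewrite lw vec1 //; exact: (lyndon_leads fbP).
    move=> /mapP[w /s2P [lw ow wl] ->]; rewrite lyndon_sq vec2.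
    by rewrite /sq (color_hom_br fhom); exact: (lyndon_sq_leads fbP).
  + have flin := color_hom_linear fhom.
    rewrite -[RHS](linear_at0 flin) -c0.
    elim/big_rec2: _ => [|j y x _ ->]; first by rewrite (linear_at0 flin).
    by rewrite flin.
- move=> v /(weight_span gammaP wfA gen_free bP LW_grading LW_gen).
  elim=> [|a x y Sx _ [c ->]].
    by exists (fun=> 0); rewrite big1 // => j _; rewrite scale0r.
  suff [j ->] : exists j : 'I_(size s), x = vec (nth [::] s j).
    exists (fun k => (if k == j then a else 0) + c k).
    under [in RHS]eq_bigr do rewrite scalerDl.
    rewrite big_split /=; congr (_ + _); rewrite (bigD1 j) //= eqxx big1 ?addr0 // => k /negPf ->.
    by rewrite scale0r.
  have {Sx} [w [ws ->]] : exists w, w \in s /\ x = vec w.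
    case: Sx => [[w [lw wl ->]]|[w [lw ow wl ->]]].
      by exists w; rewrite vec1 // mem_cat; split=> //; apply/orP; left; apply/s1P.
    exists (w ++ w); rewrite vec2 mem_cat; split=> //; apply/orP; right.
    by apply/mapP; exists w => //; apply/s2P.
  by rewrite -index_mem in ws; exists (Ordinal ws); rewrite /= nth_index // -index_mem.
Qed.

End Independence.

(** * Finite sums *)

(** Only the set of pairs is assumed to be finite: the index set [P] is often the
set of all positive integers. *)
Lemma fsum_dep (R : nmodType) (I J : choiceType) (P : set I) (Q : I -> set J)
    (f : I -> J -> R) : finite_set [set p | P p.1 /\ Q p.1 p.2] ->
  \sum_(i \in P) \sum_(j \in Q i) f i j =
  \sum_(p \in [set p | P p.1 /\ Q p.1 p.2]) f p.1 p.2.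
Proof.
set S := [set p | _] => fS.
have fI : finite_set (fst @` S) by exact: finite_image.
have fJ : finite_set (snd @` S) by exact: finite_image.
rewrite -(fsbig_widen (fst @` S) P); first last.
- move=> i [Pi nSi] /=; apply: fsbig1 => j Qj; case: nSi; by exists (i, j).
- by move=> _ [p [Pp _] <-].
transitivity (\sum_(i \in fst @` S) \sum_(j \in snd @` S)
    if (i, j) \in S then f i j else 0).
  apply: eq_fsbigr => i; rewrite inE => -[[i' j'] [/= Pi _] <-].
  rewrite -(fsbig_widen (Q i') (snd @` S)).
  - by apply: eq_fsbigr => j; rewrite inE => Qj; rewrite mem_set.
  - by move=> j Qj; exists (i', j).
  - by move=> j [_ nQ] /=; rewrite memNset // => -[].
rewrite pair_fsbig // -(fsbig_widen S); first last.
- by move=> [i j] [_ nS] /=; rewrite memNset.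
- by move=> p Sp; split; exists p.
by apply: eq_fsbigr => -[i j]; rewrite inE => Sp /=; rewrite mem_set.
Qed.

Lemma finite_sigma (I J : choiceType) (P : set I) (Q : I -> set J) :
  finite_set P -> (forall i, P i -> finite_set (Q i)) ->
  finite_set [set p | P p.1 /\ Q p.1 p.2].
Proof. exact: finite_setXR. Qed.

Lemma fsum_sigma (R : nmodType) (I J : choiceType) (P : set I) (Q : I -> set J)
    (f : I -> J -> R) : finite_set P -> (forall i, P i -> finite_set (Q i)) ->
  \sum_(i \in P) \sum_(j \in Q i) f i j =
  \sum_(p \in [set p | P p.1 /\ Q p.1 p.2]) f p.1 p.2.
Proof. by move=> fP fQ; apply: fsum_dep; exact: finite_sigma. Qed.

Lemma fsum_const (I : choiceType) (D : set I) :
  finite_set D -> \sum_(i \in D) (1 : rat) = (#|` fset_set D|)%:R.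
Proof. by move=> fD; rewrite fsbig_finite // -(natr_sum _ _ _ (fun=> 1%N)) sum1_size. Qed.

(** * The Moebius function *)
Section Mobius.

Lemma mobiusM_dvd p e : prime p -> (0 < e)%N -> (p %| e)%N -> mobius (p * e) = 0.
Proof.
move=> pp e0 pe; have p0 := prime_gt0 pp; rewrite /mobius ifF //; apply/allPn; exists p.
  by rewrite mem_primes pp muln_gt0 p0 e0 dvdn_mulr.
rewrite lognM // logn_prime // eqxx.
have : (0 < logn p e)%N by rewrite logn_gt0 mem_primes pp e0.
by case: (logn p e).
Qed.

Lemma mobiusM_ndvd p e : prime p -> (0 < e)%N -> ~~ (p %| e)%N ->
  mobius (p * e) = - mobius e.
Proof.
move=> pp e0 pe; have p0 := prime_gt0 pp.
have npe : p \notin primes e by rewrite mem_primes pp e0.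
have perm : perm_eq (primes (p * e)) (p :: primes e).
  apply: uniq_perm; rewrite ?primes_uniq //= ?npe ?primes_uniq // => q.
  by rewrite primesM // primes_prime // !inE.
rewrite /mobius (perm_all _ perm) (perm_size perm) /=.
have -> : logn p (p * e) = 1%N.
  by rewrite lognM // logn_prime // eqxx lognE pp e0 (negPf pe).
have -> : all (fun q => logn q (p * e) == 1)%N (primes e) =
          all (fun q => logn q e == 1)%N (primes e).
  apply: eq_in_all => q qe; rewrite lognM // logn_prime //.
  by have [E|//] := eqVneq q p; move: qe npe; rewrite E => ->.
by rewrite eqxx /=; case: ifP; rewrite ?oppr0 // exprS mulN1r.
Qed.

(** For a prime divisor [p] of [m], the divisors [e] prime to [p] cancel with the
[p * e], and the other divisors of the form [p * e] contribute zero. *)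
Lemma sum_mobius m : (0 < m)%N -> \sum_(n <- divisors m) mobius n = (m == 1)%N%:R.
Proof.
move=> m0; have [m1|m1] := leqP m 1.
  have -> : m = 1%N by lia.
  by rewrite big_seq1.
pose p := pdiv m; have pp : prime p by exact: pdiv_prime.
pose m' := (m %/ p)%N; have mE : m = (p * m')%N by rewrite mulnC divnK // pdiv_dvd.
have m'0 : (0 < m')%N by rewrite mE muln_gt0 in m0; case/andP: m0.
have p0 := prime_gt0 pp.
have -> : (m == 1)%N = false by case: eqP m1 => // ->.
rewrite (bigID (dvdn p)) /= -big_filter -[X in _ + X]big_filter.
rewrite (perm_big [seq (p * e)%N | e <- divisors m']); last first.
  apply: uniq_perm.
  - by rewrite filter_uniq ?divisors_uniq.
  - by rewrite map_inj_uniq ?divisors_uniq // => x y /eqP; rewrite eqn_pmul2l // => /eqP.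
  move=> x; rewrite mem_filter -dvdn_divisors //; apply/andP/mapP.
    move=> [/dvdnP[e ->]]; rewrite mE mulnC dvdn_pmul2l // => em.
    by exists e => //; rewrite -dvdn_divisors.
  by move=> [e]; rewrite -dvdn_divisors // => em ->; rewrite dvdn_mulr // mE dvdn_pmul2l.
rewrite [X in _ + X](perm_big [seq e <- divisors m' | ~~ (p %| e)%N]); last first.
  apply: uniq_perm; rewrite ?filter_uniq ?divisors_uniq // => x.
  rewrite !mem_filter -!dvdn_divisors //; case: (boolP (p %| x)%N) => //= px.
  by rewrite mE Gauss_dvdr // coprime_sym prime_coprime.
rewrite big_map big_filter /= (bigID (dvdn p)) /= big1_seq ?add0r; last first.
  move=> e /andP[pe]; rewrite -dvdn_divisors // => em.
  by rewrite mobiusM_dvd // (dvdn_gt0 _ em).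
rewrite -big_split /= big1_seq // => e /andP[pe]; rewrite -dvdn_divisors // => em.
by rewrite mobiusM_ndvd ?addNr // (dvdn_gt0 _ em).
Qed.

Definition factor_pairs (m : nat) : set (nat * nat) := [set p | (p.1 * p.2)%N = m].

Lemma factor_pairs_sum m (f : nat -> nat -> rat) : (0 < m)%N ->
  \sum_(p \in factor_pairs m) f p.1 p.2 = \sum_(n <- divisors m) f n (m %/ n)%N.
Proof.
move=> m0; rewrite [RHS]fsbig_seq ?divisors_uniq //.
apply: (reindex_fsbig (fun n => (n, m %/ n)%N) [set` divisors m] (factor_pairs m)).
split.
- move=> n /=; rewrite -dvdn_divisors // => nm.
  by rewrite /factor_pairs /= mulnC divnK.
- by move=> n n' _ _ [].
- move=> [n k] /= nk; rewrite /factor_pairs /= in nk; exists n.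
    by rewrite /= -dvdn_divisors // -nk dvdn_mulr.
  by congr pair; rewrite -nk mulKn //; move: m0; rewrite -nk muln_gt0 => /andP[].
Qed.

Lemma finite_factor_pairs m : (0 < m)%N -> finite_set (factor_pairs m).
Proof.
move=> m0; apply: (@sub_finite_set _ _ (`I_m.+1 `*` `I_m.+1)); last exact: finite_setX.
move=> [n k] /= nk; rewrite /factor_pairs /= in nk.
by move: m0; rewrite -nk muln_gt0 => /andP[n0 k0]; split; rewrite /= ltnS; nia.
Qed.

Lemma sum_mobius_pairs m : (0 < m)%N ->
  \sum_(p \in factor_pairs m) ((mobius p.1)%:~R : rat) = (m == 1)%N%:R.
Proof.
move=> m0; rewrite (factor_pairs_sum (fun n _ => (mobius n)%:~R : rat)) //.
by rewrite -(rmorph_sum (intr : int -> rat)) /= sum_mobius //; case: eqP.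
Qed.

(** [(-1) ^ k = 2 [k even] - 1], and the pairs with [k] even are those of [m / 2]. *)
Lemma sum_mobius_sign m : (0 < m)%N ->
  \sum_(p \in factor_pairs m) ((mobius p.1)%:~R * (-1) ^+ p.2 : rat) =
  ((m == 2)%N%:R : rat) *+ 2 - (m == 1)%N%:R.
Proof.
move=> m0; have fm := finite_factor_pairs m0.
transitivity (\sum_(p \in factor_pairs m)
    ((if ~~ odd p.2 then (mobius p.1)%:~R *+ 2 else 0) + (-1) * (mobius p.1)%:~R : rat)).
  apply: eq_fsbigr => -[n k] _ /=; rewrite -signr_odd.
  by case: (odd k); rewrite /= ?expr1 ?expr0; ring.
rewrite fsbig_split // -mulr_fsumr sum_mobius_pairs // mulN1r; congr (_ - _).
have [om|em] := boolP (odd m).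
  rewrite fsbig1; first by case: eqP om => // ->.
  by move=> [n k] /= nk; move: om; rewrite -nk oddM => /andP[_ ->].
have mE : m = (m./2).*2 by rewrite -[LHS]odd_double_half (negPf em).
have h0 : (0 < m./2)%N by lia.
rewrite (_ : (m == 2)%N = (m./2 == 1)%N); last by lia.
rewrite -sum_mobius_pairs // -mulr_natr mulr_fsuml.
rewrite -(fsbig_widen [set p | factor_pairs m p /\ ~~ odd p.2]); first last.
- by move=> [n k] [/= mnk nk]; rewrite ifN //; apply/negP => ok; apply: nk.
- by move=> p [].
rewrite (reindex_fsbig (fun p => (p.1, p.2.*2)) (factor_pairs m./2)).
  by apply: eq_fsbigr => -[n k] _ /=; rewrite odd_double /= mulr_natr.
split.
- by move=> [n k] /= nk; rewrite /factor_pairs /= in nk *; rewrite odd_double; split=> //; lia.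
- by move=> [n k] [n' k'] _ _ [-> /double_inj ->].
- move=> [n k] /= [nk ok]; rewrite /factor_pairs /= in nk; exists (n, k./2).
    by rewrite /factor_pairs /=; nia.
  by congr pair; rewrite -[RHS]odd_double_half (negPf ok).
Qed.

End Mobius.

(** * Counting words *)
Section Counting.
Variables (Lambda : addSemigroupType) (kappa : Lambda -> int).
Hypothesis Lambda_fin : finite_decompositions Lambda.
Hypothesis kappaP : sign_hom kappa.
Variables (d : Order.disp_t) (A : orderType d) (degL : A -> Lambda).
Hypothesis X_fin : forall l, finite_set [set x | degL x = l].

Notation wdeg := (wdeg degL).
Implicit Types (u v w : seq A) (l : Lambda).

Definition sgnw w : rat := \prod_(x <- w) (kappa (degL x))%:~R.

Lemma sgnw_cons x w : sgnw (x :: w) = (kappa (degL x))%:~R * sgnw w.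
Proof. exact: big_cons. Qed.

Lemma sgnw_cat u v : sgnw (u ++ v) = sgnw u * sgnw v.
Proof. exact: big_cat. Qed.

Lemma sgnw_wpow k v : sgnw (wpow k v) = sgnw v ^+ k.
Proof. by elim: k => [|k IH]; rewrite /= ?sgnw_cat ?IH ?exprS // /sgnw big_nil. Qed.

Lemma sgnw_rot r w : sgnw (rot r w) = sgnw w.
Proof. by apply: perm_big; rewrite perm_rot. Qed.

Lemma sgnwP w : sgnw w = 1 \/ sgnw w = -1.
Proof.
elim: w => [|x w IH]; first by left; rewrite /sgnw big_nil.
rewrite sgnw_cons; case: (sign_homP kappaP (degL x)) IH => -> [] ->;
  by [left|right].
Qed.

Lemma wdeg_rot r w : wdeg (rot r w) = wdeg w.
Proof. by apply: perm_big; rewrite perm_rot. Qed.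

Lemma wdeg_wpow k v : wdeg (wpow k v) = wdeg v *+ k.
Proof. by elim: k => [|k IH]; rewrite /= ?wdeg_nil ?mulr0n // wdeg_cat IH mulrS. Qed.

Lemma kappa_nmul n l : (0 < n)%N -> kappa (nmul n l) = kappa l ^+ n.
Proof.
case: n => // n _; rewrite /nmul /=; elim: n => [|n IH] //=.
by rewrite (sign_homD kappaP) IH -exprS.
Qed.

Definition words l : set (seq A) := [set w | wdeg w = wt l].

Lemma words_neq0 l w n : wdeg w *+ n = wt l -> (0 < size w)%N.
Proof. by case: w => // ; rewrite wdeg_nil mul0rn. Qed.

Lemma finite_map_degL s : finite_set [set w | map degL w = s].
Proof.
elim: s => [|a s IH].
  by apply: (sub_finite_set _ (finite_set1 [::])) => -[|].
apply: sub_finite_set (finite_image (fun p => p.1 :: p.2) (finite_setX (X_fin a) IH)).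
by move=> [|x w] //= [xa ws]; exists (x, w).
Qed.

(** A word is determined up to finitely many choices by the weights of its letters,
which form a decomposition of [l]. *)
Lemma finite_words l : finite_set (words l).
Proof.
have : finite_set (\bigcup_(s in [set s : Lambda * seq Lambda | foldr +%R s.1 s.2 = l])
    [set w | map degL w = s.1 :: s.2]).
  by apply: bigcup_finite => // s _; exact: finite_map_degL.
apply: sub_finite_set => -[|x w]; rewrite /words /mkset ?wdeg_nil // wdeg_cons => wl.
exists (degL x, map degL w) => //=; apply: wt_inj; rewrite -wl {wl}.
elim: w => [|y w IH] /=; first by rewrite wdeg_nil addr0.
by rewrite -wtD IH wdeg_cons addrCA.
Qed.

(** Words with a multiplicity [n] by which their weight is multiplied; the word [w]
counted with [n] comes from the dilation of index [n]. *)
Definition pair_words l : set (nat * seq A) :=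
  [set p | (0 < p.1)%N /\ wdeg p.2 *+ p.1 = wt l].

Lemma finite_pair_words l : finite_set (pair_words l).
Proof.
have : finite_set (\bigcup_(u in words l)
    (`I_(size u).+1 `*` ((fun k => take k u) @` `I_(size u).+1))).
  apply: bigcup_finite; first exact: finite_words.
  by move=> u _; apply: finite_setX => //; exact: finite_image.
apply: sub_finite_set => -[n w] [/= n0 wl].
have w0 := words_neq0 wl.
exists (wpow n w); first by rewrite /words /= wdeg_wpow.
split=> /=; first by rewrite size_wpow; nia.
exists (size w); first by rewrite /= size_wpow; nia.
by case: n n0 {wl} => //= n _; rewrite take_size_cat.
Qed.

Definition root_words n k l : set (seq A) :=
  [set w | size w = k /\ wdeg w *+ n = wt l].

Lemma finite_root_words n k l : (0 < n)%N -> finite_set (root_words n k l).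
Proof.
move=> n0; apply: sub_finite_set (finite_image snd (finite_pair_words l)).
by move=> w [_ wl]; exists (n, w).
Qed.

Definition root_letters n l : set A := [set x | nmul n (degL x) = l].

Lemma finite_root_letters n l : (0 < n)%N -> finite_set (root_letters n l).
Proof.
move=> n0; apply: sub_finite_set (bigcup_finite (finite_nmul Lambda_fin l n0)
  (fun m _ => X_fin m)).
by move=> x xl; exists (degL x).
Qed.

(** The sign of [E^l = kappa(l) e^l] appears once for the letter and, after the
dilation, once for its [n]-th multiple. *)
Lemma dilation_letters n l : (0 < n)%N ->
  dilation kappa n (ch_set degL) l =
  \sum_(x \in root_letters n l) ((kappa (degL x))%:~R ^+ n.+1 : rat).
Proof.
move=> n0; rewrite /dilation mulr_fsumr.
transitivity (\sum_(m \in [set m | nmul n m = l]) \sum_(x \in [set x | degL x = m])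
    ((kappa l)%:~R * (kappa m)%:~R : rat)).
  apply: eq_fsbigr => m _; rewrite /Ecoef /ch_set -fsum_const // mulrA mulr_fsumr.
  by apply: eq_fsbigr => x _; rewrite mulr1.
rewrite fsum_sigma; [|exact: finite_nmul|by move=> m _; exact: X_fin].
rewrite (reindex_fsbig (fun x => (degL x, x)) (root_letters n l)).
  apply: eq_fsbigr => x; rewrite inE => xl /=.
  by rewrite -[in LHS]xl kappa_nmul // rmorphXn exprSr.
split.
- by move=> x xl.
- by move=> x y _ _ [].
- by move=> [m x] /= [ml xm]; exists x; rewrite /root_letters /= ?xm.
Qed.

(** Both sides satisfy the same recursion on [k], by splitting off the first letter
of [w]. *)
Lemma spow_words n k l : (0 < n)%N -> (0 < k)%N ->
  spow (- dilation kappa n (ch_set degL)) k l =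
  (-1) ^+ k * \sum_(w \in root_words n k l) sgnw w ^+ n.+1.
Proof.
move=> n0; case: k => // k _; elim: k l => [|k IH] l.
  rewrite /spow /= expr1 mulN1r -[LHS]/(- dilation _ _ _ _) dilation_letters //; congr (- _).
  rewrite (reindex_fsbig (fun x => [:: x]) (root_letters n l)).
    by apply: eq_fsbigr => x _; rewrite /sgnw big_seq1.
  split.
  - by move=> x xl; split=> //; rewrite wdeg1 wt_nmul // xl.
  - by move=> x y _ _ [].
  - move=> [|x [|y w]] [//= _]; rewrite wdeg1 wt_nmul // => /wt_inj xl.
    by exists x.
rewrite -[LHS]/(smul (- dilation kappa n (ch_set degL))
   (spow (- dilation kappa n (ch_set degL)) k.+1) l) /smul.
transitivity (\sum_(p \in [set p : Lambda * Lambda | p.1 + p.2 = l])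
    \sum_(q \in root_letters n p.1 `*` root_words n k.+1 p.2)
      ((-1) ^+ k.+2 * sgnw (q.1 :: q.2) ^+ n.+1)).
  apply: eq_fsbigr => -[a c] _ /=; rewrite IH -[(- _) a]/(- dilation _ _ _ _).
  rewrite dilation_letters //.
  transitivity (\sum_(x \in root_letters n a) \sum_(w \in root_words n k.+1 c)
      ((-1) ^+ k.+2 * sgnw (x :: w) ^+ n.+1)).
    set V := \sum_(w \in root_words _ _ _) sgnw w ^+ _.
    set U := \sum_(x \in _) (_ ^+ _ : rat).
    transitivity ((-1) ^+ k.+2 * U * V).
      by rewrite [in RHS]exprS; move: ((-1) ^+ k.+1) => e; ring.
    rewrite -mulrA mulr_fsuml mulr_fsumr; apply: eq_fsbigr => x _.
    rewrite !mulr_fsumr; apply: eq_fsbigr => w _.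
    by rewrite sgnw_cons exprMn.
  by rewrite pair_fsbig; [|exact: finite_root_letters|exact: finite_root_words].
rewrite fsum_sigma; [|exact: finite_smul|]; last first.
  by move=> p _; apply: finite_setX; [exact: finite_root_letters|exact: finite_root_words].
rewrite mulr_fsumr [RHS](reindex_fsbig (fun s => s.2.1 :: s.2.2) [set s |
  s.1.1 + s.1.2 = l /\ (root_letters n s.1.1 `*` root_words n k.+1 s.1.2) s.2]) //.
split.
- move=> [[a c] [x w]] /= [acl [xa [sw wc]]]; split=> /=; first by rewrite sw.
  rewrite /root_letters /= in xa.
  by rewrite wdeg_cons mulrnDl wt_nmul // xa wc wtD acl.
- move=> [[a c] [x w]] [[a' c'] [x' w']]; rewrite !inE /= => -[_ [xa [_ wc]]] [_ [xa' [_ wc']]] [e1 e2].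
  rewrite /root_letters /= in xa xa'; rewrite e1 in xa *; rewrite e2 in wc *.
  by rewrite -xa xa' (wt_inj (etrans (esym wc) wc')).
- move=> [|x w] /= [// [sw] wl].
  have [|m mE] := @wdeg_neq0 _ _ degL w; first by move=> w0; rewrite w0 in sw.
  move: wl; rewrite wdeg_cons mulrnDl mE !wt_nmul // wtD => /wt_inj wl.
  exists ((nmul n (degL x), nmul n m), (x, w)) => //=; split=> //.
  by split=> //; split=> //=; rewrite mE wt_nmul.
Qed.

Lemma sln1p_words n l : (0 < n)%N ->
  sln1p (- dilation kappa n (ch_set degL)) l =
  - \sum_(w \in [set w | wdeg w *+ n = wt l]) (sgnw w ^+ n.+1 / (size w)%:R : rat).
Proof.
move=> n0; rewrite /sln1p /ssum -[RHS]mulN1r [RHS]mulr_fsumr.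
transitivity (\sum_(k \in [set k | (0 < k)%N]) \sum_(w \in root_words n k l)
    (-1 * (sgnw w ^+ n.+1 / k%:R))).
  apply: eq_fsbigr => k; rewrite inE => k0; rewrite /sscale spow_words // mulrA mulr_fsumr.
  have e : (-1) ^+ k.+1 * (-1) ^+ k = -1 :> rat.
    by rewrite -exprD addSn addnn -signr_odd /= odd_double expr1.
  apply: eq_fsbigr => w _; rewrite -[X in _ = X * _]e.
  by move: ((-1) ^+ k) ((-1) ^+ k.+1) (sgnw w ^+ n.+1) (k%:R^-1) => *; ring.
rewrite fsum_dep; last first.
  apply: sub_finite_set (finite_image (fun p => (size p.2, p.2)) (finite_pair_words l)).
  by move=> [k w] [/= k0 [wk wl]]; exists (n, w); rewrite ?wk.
rewrite [RHS](reindex_fsbig snd [set p | (0 < p.1)%N /\ root_words n p.1 l p.2]).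
  by apply: eq_fsbigr => -[k w]; rewrite inE => -[_ [/= -> _]].
split.
- by move=> [k w] [_ []].
- move=> [k w] [k' w']; rewrite !inE => -[_ [/= <- _]] [_ [/= <- _]].
  by rewrite /= => ->.
- move=> w /= wl; exists (size w, w) => //=; split=> //; exact: words_neq0 wl.
Qed.

Lemma rhs_words l :
  (- ssum (fun n => sscale ((mobius n)%:~R / n%:R)
            (sln1p (- dilation kappa n (ch_set degL))))) l =
  \sum_(p \in pair_words l)
     (mobius p.1)%:~R / p.1%:R * (sgnw p.2 ^+ p.1.+1 / (size p.2)%:R).
Proof.
rewrite -[LHS]/(- ssum _ _) /ssum -[LHS]mulN1r [LHS]mulr_fsumr.
transitivity (\sum_(n \in [set n | (0 < n)%N])
    \sum_(w \in [set w | wdeg w *+ n = wt l])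
     ((mobius n)%:~R / n%:R * (sgnw w ^+ n.+1 / (size w)%:R) : rat)).
  apply: eq_fsbigr => n; rewrite inE => n0.
  by rewrite /sscale sln1p_words // mulN1r mulrN opprK mulr_fsumr.
by rewrite fsum_dep; [|exact: finite_pair_words].
Qed.

Definition lyndon_roots l : set (seq A * nat) :=
  [set p | [/\ lyndon p.1, (0 < p.2)%N & wdeg p.1 *+ p.2 = wt l]].

Lemma finite_lyndon_roots l : finite_set (lyndon_roots l).
Proof.
apply: sub_finite_set (finite_image (fun p => (p.2, p.1)) (finite_pair_words l)).
by move=> [v m] [/= _ m0 vl]; exists (m, v).
Qed.

(** The word of a pair [(n, w)] is [rot r (wpow k v)]; the terms are grouped by
[v] and [m = n k]. *)
Lemma necklace_sum l (g : nat -> seq A -> rat) :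
  \sum_(p \in pair_words l) g p.1 p.2 =
  \sum_(p \in lyndon_roots l) \sum_(q \in factor_pairs p.2 `*` `I_(size p.1))
     g q.1.1 (rot q.2 (wpow q.1.2 p.1)).
Proof.
rewrite [RHS]fsum_sigma; [|exact: finite_lyndon_roots|]; last first.
  by move=> [v m] [_ m0 _]; apply: finite_setX => //; exact: finite_factor_pairs.
rewrite (reindex_fsbig (fun s : (seq A * nat) * ((nat * nat) * nat) =>
    (s.2.1.1, rot s.2.2 (wpow s.2.1.2 s.1.1)))
  [set s | lyndon_roots l s.1 /\ (factor_pairs s.1.2 `*` `I_(size s.1.1)) s.2]) //.
split.
- move=> [[v m] [[n k] r]] [[/= lv m0 vl] [/= nk rv]]; rewrite /factor_pairs /= in nk.
  split; first by move: m0; rewrite -nk muln_gt0 => /andP[].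
  by rewrite /= wdeg_rot wdeg_wpow -mulrnA mulnC nk.
- move=> [[v m] [[n k] r]] [[v' m'] [[n' k'] r']]; rewrite !inE.
  move=> [[/= lv m0 vl] [/= nk rv]] [[/= lv' m0' vl'] [/= nk' rv']] [nn'].
  rewrite /factor_pairs /= in nk nk'.
  have k0 : (0 < k)%N by move: m0; rewrite -nk muln_gt0 => /andP[].
  have k0' : (0 < k')%N by move: m0'; rewrite -nk' muln_gt0 => /andP[].
  move=> /(necklace_uniq lv lv' k0 k0' rv rv')[-> kk' ->].
  by rewrite -nk -nk' nn' kk'.
- move=> [n w] [/= n0 wl].
  have [|v [k [r [lv k0 rv wE]]]] := @necklace_exists _ _ w.
    by rewrite neq_nil (words_neq0 wl).
  exists ((v, (n * k)%N), ((n, k), r)); rewrite -?wE //=; split=> //.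
  split=> //=; first by rewrite muln_gt0 n0.
  by rewrite -wl wE wdeg_rot wdeg_wpow mulnC mulrnA.
Qed.

(** The exponent of [s] is [m + k] on the pairs [n k = m], so that a factor
[s ^ m / m] comes out and a sum of [mu(n)] or of [mu(n) (-1) ^ k] is left. *)
Lemma local_term (s : rat) m : s = 1 \/ s = -1 -> (0 < m)%N ->
  \sum_(p \in factor_pairs m)
    ((mobius p.1)%:~R / p.1%:R * (s ^+ (p.2 * p.1.+1) / p.2%:R)) =
  (m == 1)%N%:R + ((m == 2)%N && (s == -1))%:R.
Proof.
move=> s1 m0; have mn0 : m%:R != 0 :> rat by rewrite pnatr_eq0 -lt0n.
transitivity (s ^+ m / m%:R * \sum_(p \in factor_pairs m) ((mobius p.1)%:~R * s ^+ p.2)).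
  rewrite mulr_fsumr; apply: eq_fsbigr => -[n k]; rewrite inE /factor_pairs /= => nk.
  rewrite mulnSr exprD -nk natrM [(n * k)%N]mulnC; field.
  rewrite !pnatr_eq0; move: m0; rewrite -nk muln_gt0 => /andP[].
  by rewrite !lt0n => -> ->.
case: s1 => ->.
  transitivity (1 ^+ m / m%:R * \sum_(p \in factor_pairs m) ((mobius p.1)%:~R : rat)).
    by congr (_ * _); apply: eq_fsbigr => p _; rewrite expr1n mulr1.
  rewrite sum_mobius_pairs // expr1n andbF addr0.
  by case: eqP => [->|_]; rewrite ?mulr0 // invr1 !mulr1.
rewrite sum_mobius_sign // eqxx andbT.
have [->|m1] := eqVneq m 1%N; first by [].
have [->|m2] := eqVneq m 2%N; first by [].
by rewrite /= mul0rn subr0 mulr0.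
Qed.

Definition lyndon_odd l : set (seq A) :=
  [set w | [/\ lyndon w, sgnw w = -1 & wdeg w *+ 2 = wt l]].

Lemma finite_lyndon_of l : finite_set (lyndon_of degL l).
Proof.
by apply: sub_finite_set (finite_words l) => w [].
Qed.

Lemma finite_lyndon_odd l : finite_set (lyndon_odd l).
Proof.
apply: sub_finite_set (finite_image fst (finite_lyndon_roots l)) => w [lw _ wl].
by exists (w, 2%N).
Qed.

Theorem rhs_count l :
  (- ssum (fun n => sscale ((mobius n)%:~R / n%:R)
            (sln1p (- dilation kappa n (ch_set degL))))) l =
  (#|` fset_set (lyndon_of degL l)| + #|` fset_set (lyndon_odd l)|)%:R.
Proof.
rewrite rhs_words (necklace_sum l (fun n w =>
  (mobius n)%:~R / n%:R * (sgnw w ^+ n.+1 / (size w)%:R))).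
transitivity (\sum_(p \in lyndon_roots l)
    ((p.2 == 1)%N%:R + ((p.2 == 2)%N && (sgnw p.1 == -1))%:R : rat)).
  apply: eq_fsbigr => -[v m]; rewrite inE => -[/= lv m0 vl].
  rewrite -(local_term (sgnwP v) m0).
  rewrite -(pair_fsbig _ (fun nk r => (mobius nk.1)%:~R / nk.1%:R *
    (sgnw (rot r (wpow nk.2 v)) ^+ nk.1.+1 / (size (rot r (wpow nk.2 v)))%:R))) //; last first.
    exact: finite_factor_pairs.
  apply: eq_fsbigr => -[n k]; rewrite inE /factor_pairs /= => nk.
  rewrite -fsbig_ord; under eq_bigr do rewrite sgnw_rot size_rot sgnw_wpow size_wpow.
  rewrite sumr_const card_ord -exprM -mulr_natr natrM.
  have v0 : (size v)%:R != 0 :> rat by rewrite pnatr_eq0 -lt0n -neq_nil lyndon_neq0.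
  field; rewrite v0 /= !pnatr_eq0; move: m0; rewrite -nk muln_gt0 => /andP[].
  by rewrite !lt0n => -> ->.
rewrite fsbig_split ?natrD //; last exact: finite_lyndon_roots.
rewrite -!fsum_const; [|exact: finite_lyndon_odd|exact: finite_lyndon_of].
congr (_ + _).
  rewrite -(fsbig_widen [set p | lyndon_roots l p /\ p.2 = 1%N]); first last.
  - by move=> [v m] [/= vl nm]; case: eqP => // m1; case: nm.
  - by move=> p [].
  rewrite (reindex_fsbig (fun v => (v, 1%N)) (lyndon_of degL l)) //.
  split.
  - by move=> v [lv vl]; split=> //; split=> //=; rewrite mulr1n.
  - by move=> v v' _ _ [].
  - by move=> [v m] /= [[/= lv m0 vl] m1]; exists v; rewrite ?m1 //; split=> //; rewrite -vl m1.
rewrite -(fsbig_widen [set p | [/\ lyndon_roots l p, p.2 = 2%N & sgnw p.1 = -1]]); first last.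
- by move=> [v m] [/= vl nm]; case: eqP => // m1; case: eqP => // sv; case: nm.
- by move=> p [].
rewrite (reindex_fsbig (fun v => (v, 2%N)) (lyndon_odd l)).
  by apply: eq_fsbigr => v; rewrite inE => -[_ /= -> _].
split.
- by move=> v [lv sv vl].
- by move=> v v' _ _ [].
- by move=> [v m] /= [[/= lv m0 vl] m1 sv]; exists v; rewrite ?m1 //; split=> //; rewrite -vl m1.
Qed.

End Counting.

(** * The theorem *)
Section Encoded.
Variables (X : choiceType) (code : X -> nat).

(** A copy of [X], to carry the order transported by [code]. *)
Definition encoded (_ : injective code) : Type := X.
Variable code_inj : injective code.
Local Notation E := (encoded code_inj).

HB.instance Definition _ := Choice.copy E X.

Definition encoded_le : rel E := fun x y => (code x <= code y)%N.

Lemma encoded_le_anti : antisymmetric encoded_le.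
Proof. by move=> x y; rewrite /encoded_le -eqn_leq => /eqP /code_inj. Qed.
Lemma encoded_le_trans : transitive encoded_le.
Proof. by move=> y x z; exact: leq_trans. Qed.
Lemma encoded_le_total : total encoded_le.
Proof. by move=> x y; exact: leq_total. Qed.

HB.instance Definition _ := Order.isOrder.Build (Order.Disp tt tt) E
  (fun _ _ => erefl) (fun _ _ => erefl) (fun _ _ => erefl)
  encoded_le_anti encoded_le_trans encoded_le_total.

Lemma encoded_wf : well_founded (fun x y : E => (x < y)%O).
Proof.
suff h n (x : E) : (code x < n)%N -> Acc (fun x y : E => (x < y)%O) x.
  by move=> x; exact: (h (code x).+1 x (ltnSn _)).
elim: n x => [x|n IH x xn]; first by rewrite ltn0.
constructor => y; rewrite lt_neqAle => /andP[yx lexy]; apply: IH.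
rewrite ltnS in xn; apply: leq_trans xn; rewrite ltn_neqAle; apply/andP; split; last exact: lexy.
by apply: contra yx => /eqP /code_inj ->.
Qed.
End Encoded.

Section Parity.
Variables (F : fieldType) (G : groupType) (gamma : G -> G -> F).
Hypothesis gammaP : skew_bicharacter gamma.
Variables (Lambda : addSemigroupType) (kappa : Lambda -> int).
Hypothesis kappaP : sign_hom kappa.
Variables (d : Order.disp_t) (A : orderType d) (degG : A -> G) (degL : A -> Lambda).
Hypothesis deg_even : forall x, kappa (degL x) = 1 -> Gplus gamma (degG x).
Hypothesis deg_odd : forall x, kappa (degL x) = -1 -> Gminus gamma (degG x).

(** [gamma g g] is multiplicative in [g], because of the skew symmetry of [gamma].
In characteristic two there is no odd letter, so that [1 = -1] is harmless. *)
Lemma word_parity (w : seq A) : sgnw kappa degL w = -1 <-> Gminus gamma (gdeg degG w).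
Proof.
suff [[-> e]|[-> [e n]]] : (sgnw kappa degL w = 1 /\ gamma (gdeg degG w) (gdeg degG w) = 1) \/
  (sgnw kappa degL w = -1 /\ gamma (gdeg degG w) (gdeg degG w) = -1 /\ -1 <> 1 :> F).
- by split=> // h; case: (h e).
- by split=> // _; rewrite /Gminus /Gplus /= e.
elim: w => [|x w IH].
  left; rewrite /sgnw big_nil; split=> //=.
  have := bicharMl gammaP 1%g 1%g 1%g; rewrite mulg1 => /eqP.
  rewrite -[X in X == _]mulr1 (inj_eq (mulfI _)) ?bichar_neq0 // eq_sym.
  by move/eqP.
have -> : gamma (gdeg degG (x :: w)) (gdeg degG (x :: w)) =
    gamma (degG x) (degG x) * gamma (gdeg degG w) (gdeg degG w).
  rewrite /= bicharMl // !bicharMr // mulrA -(mulrA (gamma _ _)) bichar_skew //.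
  by rewrite mulr1.
rewrite sgnw_cons; case: (sign_homP kappaP (degL x)) => kx.
  by rewrite kx mulr1z mul1r [gamma (degG x) _](deg_even kx) mul1r.
have ox := deg_odd kx; rewrite kx mulrN1z mulN1r (gamma_odd gammaP ox) mulN1r.
have n1 : -1 <> 1 :> F by move=> e; apply: (ox); rewrite /Gplus /= (gamma_odd gammaP ox).
by case: IH => [[-> ->]|[-> [-> _]]]; [right|left]; rewrite ?opprK.
Qed.

End Parity.

Theorem theorem2p4p2
  (F : fieldType) (G : groupType) (mulGC : forall g h : G, commute g h)
  (gamma : G -> G -> F) (gammaP : skew_bicharacter gamma)
  (Lambda : addSemigroupType) (Lambda_countable : countable [set: Lambda])
  (Lambda_fin : finite_decompositions Lambda)
  (kappa : Lambda -> int) (kappaP : sign_hom kappa)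
  (X : choiceType) (degG : X -> G) (degL : X -> Lambda)
  (deg_even : forall x, kappa (degL x) = 1 -> Gplus gamma (degG x))
  (deg_odd : forall x, kappa (degL x) = -1 -> Gminus gamma (degG x))
  (X_fin : forall lambda, finite_set [set x | degL x = lambda])
  (L : colorLie gamma) (i : X -> L) (L_free : is_free_colorLie degG i)
  (LW : Lambda -> set L) (LW_grading : is_weight_grading kappa LW)
  (LW_gen : forall x, LW (degL x) (i x)) :
  (forall lambda, exists d : nat, has_dim (LW lambda) d) /\
  ch_space LW =
    - ssum (fun n => sscale ((mobius n)%:~R / n%:R)
                       (sln1p (- dilation kappa n (ch_set degL)))).
Proof.
have [code code_inj] : exists code : X -> nat, injective code.
  have cX : countable [set: X].
    rewrite (_ : setT = \bigcup_(l in [set: Lambda]) [set x | degL x = l]); last first.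
      by apply/seteqP; split=> // x _; exists (degL x).
    by apply: bigcup_countable => // l _; exact: finite_set_countable.
  have /countable_injP[f fi] := cX.
  by exists f => x y; apply: fi; rewrite inE.
pose A := encoded code_inj.
have dimL l : has_dim (LW l)
    (#|` fset_set (lyndon_of (A := A) degL l)| + #|` fset_set (lyndon_odd kappa (A := A) degL l)|).
  have f1 := finite_lyndon_of Lambda_fin (A := A) X_fin l.
  have f2 := finite_lyndon_odd kappa Lambda_fin (A := A) X_fin l.
  have e : lyndon_half gamma (A := A) degG degL l = lyndon_odd kappa (A := A) degL l.
    apply/seteqP; split=> w [lw h wl]; split=> //;
      exact/(word_parity gammaP kappaP (A := A) deg_even deg_odd).
  rewrite -e in f2 *.
  exact: (weight_dim mulGC gammaP (@encoded_wf _ _ code_inj) L_free LW_grading LW_gen f1 f2).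
split; first by move=> l; exists (#|` fset_set (lyndon_of (A := A) degL l)| +
   #|` fset_set (lyndon_odd kappa (A := A) degL l)|)%N.
apply/funext => l; rewrite /ch_space (dimension_eq (dimL l)).
(* the cardinality of a finite set does not depend on the structure of its type *)
have -> : ch_set degL = ch_set (X := A) degL.
  apply/funext => m; rewrite /ch_set; congr _%:R.
  have /finite_setP[n Dn] := X_fin m.
  by rewrite (card_fset_set Dn) (@card_fset_set A _ _ Dn).
by rewrite -(rhs_count Lambda_fin kappaP (A := A) X_fin).
Qed.
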